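(* For all $y_0\in E$, define the function $\phi^{[y_0]}$ on $E$ by $\phi^{[y_0]}(y)=\mathbb Q_y^{[y_0]}(1)$. Then: (i) $\phi^{[x_0]}=\phi$, and for all $y_0\in E$, $\phi^{[y_0]}-\phi$ is a bounded function. (ii) For all $y_0\in E$: $\phi^{[y_0]}$ is finite and harmonic outside of $y_0$, i.e. $\mathbb E_y[\phi^{[y_0]}(X_1)]=\phi^{[y_0]}(y)$ for all $y\ne y_0$; $\phi^{[y_0]}(y_0)=0$; and $\widetilde{\mathbb Q}_{y_0}(1)=\mathbb E_{y_0}[\phi^{[y_0]}(X_1)]$. (iii) The point $y_0$ and the function $\phi^{[y_0]}$ can be used (in place of $x_0$ and $\phi$) to construct a family $\left(\mathbb Q_x^{(\phi^{[y_0]},y_0)}\right)_{x\in E}$ of $\sigma$-finite measures, and this family is equal to $\left(\mathbb Q_x=\mathbb Q_x^{(\phi,x_0)}\right)_{x\in E}$. (iv) For all $y_0,y\in E$, the image of $\mathbb Q_y$ by the total local time at $y_0$ is given by $$\mathbb Q_y[L_\infty^{y_0}=0]=\phi^{[y_0]}(y),\qquad \mathbb Q_y[L_\infty^{y_0}=k]=\mathbb E_{y_0}[\phi^{[y_0]}(X_1)]\quad\text{for all }k\ge1 .$$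
   Context: $E$ is a countable set, $(X_n)_{n\ge0}$ the canonical process on $E^{\mathbb N}$, $\mathcal F_n=\sigma(X_0,\dots,X_n)$, $\mathcal F_\infty=\sigma(X_n,n\ge0)$. $(\mathbb P_x)_{x\in E}$ are the laws (expectations $\mathbb E_x$) of a time-homogeneous Markov chain with transition probabilities $(p_{y,z})$, $\mathbb P_x(X_0=x)=1$. Assumptions: for every $x$, $\{y:p_{x,y}>0\}$ is finite; for all $x,y$ there is $n\in\mathbb N$ with $\mathbb P_x(X_n=y)>0$; for every $x$ the canonical process is recurrent under $\mathbb P_x$. For $y\in E$, $L_k^y=\sum_{m=0}^k1_{X_m=y}$ $(k\ge0)$, $L_{-1}^y=0$, $L_\infty^y=\lim_kL_k^y$. Construction: given a point $x_0\in E$ and $\phi:E\to\mathbb R_+$ with $\phi(x_0)=0$, $\mathbb E_x[\phi(X_1)]=\phi(x)$ for all $x\ne x_0$, and $\phi$ unbounded, set for $r\in(0,1)$ $\psi_r(x)=\frac r{1-r}\mathbb E_{x_0}[\phi(X_1)]+\phi(x)$; let $\mu_x^{(r)}$ be the finite measure on $(E^{\mathbb N},\mathcal F_\infty)$ with $\mu_x^{(r)}|_{\mathcal F_n}=\psi_r(X_n)r^{L_{n-1}^{x_0}}\cdot\mathbb P_x|_{\mathcal F_n}$ for all $n$; then $\mathbb Q_x^{(\phi,x_0)}=r^{-L_\infty^{x_0}}\cdot\mu_x^{(r)}$ is a $\sigma$-finite measure not depending on $r\in(0,1)$. In the theorem $x_0$ and $\phi$ are fixed and $\mathbb Q_x=\mathbb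 Q_x^{(\phi,x_0)}$. $\mathbb Q_y^{[y_0]}=1_{\{\forall n\ge0,\,X_n\ne y_0\}}\cdot\mathbb Q_y$ is the restriction of $\mathbb Q_y$ to trajectories which do not hit $y_0$, and $\widetilde{\mathbb Q}_{y_0}=1_{\{\forall n\ge1,\,X_n\ne y_0\}}\cdot\mathbb Q_{y_0}$ is the restriction of $\mathbb Q_{y_0}$ to trajectories which do not return to $y_0$. *)

(* Defs.v *)
From mathcomp Require Export all_boot all_order all_algebra.
From mathcomp Require Export all_classical all_reals all_analysis.

Set Implicit Arguments.
Unset Strict Implicit.
Unset Printing Implicit Defensive.
Import Order.TTheory GRing.Theory Num.Theory.
Local Open Scope classical_set_scope.
Local Open Scope ring_scope.
Local Open Scope ereal_scope.

(* Every subset of E is taken measurable: E is meant to be countable, with its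
   discrete sigma-algebra.  [E : pointedType] is what [g_sigma_algebraType]
   requires of E^nat; the distinguished point plays no role. *)
Section traj_space.
Context {E : pointedType}.

Definition coord_events (N : set nat) : set (set (nat -> E)) :=
  [set A | exists2 n, N n & exists B : set E, A = (fun w => w n) @^-1` B].

(* sigma(X_0, ..., X_n) *)
Definition Fn (n : nat) : set (set (nat -> E)) :=
  <<s coord_events [set m | (m <= n)%N] >>.

Definition Finf_gen : set (set (nat -> E)) := coord_events [set: nat].

End traj_space.

(* (E^nat, F_oo) *)
Notation traj E := (g_sigma_algebraType (@Finf_gen E)).

Definition X {E : pointedType} (n : nat) (w : traj E) : E := w n.

Lemma measurable_coord {E : pointedType} (n : nat) (B : set E) :
  measurable ((@X E n) @^-1` B).
Proof. by apply: sub_sigma_algebra; exists n => //; exists B. Qed.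

(* trajectories that are never at y at a time n >= i *)
Definition avoids {E : pointedType} (i : nat) (y : E) : set (traj E) :=
  [set w | forall n, (i <= n)%N -> X n w <> y].

Lemma measurable_avoids {E : pointedType} (i : nat) (y : E) :
  measurable (avoids i y).
Proof.
rewrite (_ : avoids i y =
  \bigcap_(n in [set n | (i <= n)%N]) ((@X E n) @^-1` [set~ y])); last by [].
by apply: bigcap_measurableType => n _; exact: measurable_coord.
Qed.

Section local_time.
Context {R : realType} {E : pointedType}.

(* Shifted index: [Lpre y n] is L_{n-1}^y, the number of visits to y strictly
   before time n, so that [Lpre y 0] is L_{-1}^y = 0. *)
Definition Lpre (y : E) (n : nat) (w : traj E) : nat :=
  (\sum_(m < n) (X m w == y))%N.

Definition Loo (y : E) (w : traj E) : \bar R :=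
  limn (fun n => (Lpre y n w)%:R%:E).

(* r^{- L_oo^y}, equal to +oo when r < 1 and L_oo^y = +oo *)
Definition rNLoo (r : R) (y : E) (w : traj E) : \bar R :=
  limn (fun n => (r ^- Lpre y n w)%:E).

End local_time.

Section chain.
Context {R : realType} {E : pointedType}.

Record markov_chain (p : E -> E -> R) (P : E -> probability (traj E) R) :
    Prop := {
  mc_ge0 : forall y z, (0 <= p y z)%R ;
  mc_sum : forall y, \esum_(z in [set: E]) (p y z)%:E = 1 ;
  mc_start : forall x, P x [set w | X 0 w = x] = 1 ;
  mc_step : forall x n (A : set (traj E)) y z, Fn n A ->
    P x (A `&` [set w | X n w = y] `&` [set w | X n.+1 w = z]) =
    P x (A `&` [set w | X n w = y]) * (p y z)%:E }.

Definition finite_branching (p : E -> E -> R) : Prop :=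
  forall x, finite_set [set y | (0 < p x y)%R].

Variable P : E -> probability (traj E) R.

Definition irreducible_chain : Prop :=
  forall x y, exists n, 0 < P x [set w | X n w = y].

Definition recurrent_chain : Prop :=
  forall x, P x [set w | exists2 n, (1 <= n)%N & X n w = x] = 1.

(* E_x[f(X_1)] *)
Definition Enext (f : E -> \bar R) (x : E) : \bar R := \int[P x]_w f (X 1 w).

(* the conditions required of a point x0 and a function phi for the
   construction of the family Q^{(phi, x0)} *)
Record admissible (phi : E -> R) (x0 : E) : Prop := {
  adm_ge0 : forall x, (0 <= phi x)%R ;
  adm_x0 : phi x0 = 0%R ;
  adm_harmonic : forall x, x <> x0 -> Enext (EFin \o phi) x = (phi x)%:E ;
  adm_unbounded : ~ exists M : R, forall x, (phi x <= M)%R }.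

Definition psi (phi : E -> R) (x0 : E) (r : R) (x : E) : R :=
  (r / (1 - r) * fine (Enext (EFin \o phi) x0) + phi x)%R.

Definition is_mu (phi : E -> R) (x0 : E) (r : R) (x : E)
    (mu : set (traj E) -> \bar R) : Prop :=
  forall n (A : set (traj E)), Fn n A ->
    mu A = \int[P x]_(w in A) (psi phi x0 r (X n w) * r ^+ Lpre x0 n w)%:E.

(* (Q x)_x is the family of measures r^{- L_oo^{x0}} . mu_x^{(r)} built from
   phi, x0 and r *)
Definition is_Qfamily (phi : E -> R) (x0 : E) (r : R)
    (Q : E -> {measure set (traj E) -> \bar R}) : Prop :=
  forall x, exists2 mu : {finite_measure set (traj E) -> \bar R},
    is_mu phi x0 r x mu &
    forall A, measurable A -> Q x A = \int[mu]_(w in A) rNLoo r x0 w.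

Variable Q : E -> {measure set (traj E) -> \bar R}.

(* Q_y^{[y0]} *)
Definition Qavoid (y0 y : E) : set (traj E) -> \bar R :=
  mrestr (Q y) (measurable_avoids 0 y0).

(* the measure Q~_{y0} *)
Definition Qnoreturn (y0 : E) : set (traj E) -> \bar R :=
  mrestr (Q y0) (measurable_avoids 1 y0).

Definition phibr (y0 y : E) : \bar R := Qavoid y0 y [set: traj E].

End chain.

(* Main.v *)
From HB Require Import structures.
Require Import Defs.
From mathcomp Require Import measurable_realfun.
Set Implicit Arguments.
Unset Strict Implicit.
Unset Printing Implicit Defensive.
Import Order.TTheory GRing.Theory Num.Theory.
Local Open Scope classical_set_scope.
Local Open Scope ring_scope.
Local Open Scope ereal_scope.

(** The measures built from [phi], [z] and [r] are best described by an identity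
    that does not involve [r]: for an event [A] known at time [n],

      [Q x (A `&` avoids n z)] is the integral of [phi (X n)] on [A] under [P x],

    and [Q x]-almost no trajectory visits [z] infinitely often. Call this a
    last-exit family for [phi] and [z]. Since the trajectories that eventually
    avoid [z] carry all the mass, the identity determines [Q]
    ([measure_ext_avoids]).

    Being a last-exit family is equivalent to coming from the construction. In
    one direction ([last_exit_of_construction]), [phi] stopped at [z] is a
    martingale, the constant part of [psi] disappears by recurrence, and the
    weights [r ^+ L] and [r ^- L] cancel. In the other one
    ([construction_of_last_exit]), cutting trajectories at their last visit to
    [z] gives the joint law of the past and of the total local time
    ([last_exit_total_visits]): after the past, each further value of the local
    time has the same mass [Enext phi z]. Weighting the value [k] by [s ^+ k] and
    summing a geometric series gives the density with [psi]. The law of the total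
    local time is the same formula at time 0.

    The identity implies the Markov property of [Q]: for [A] known at time [n],
    the mass of [A] followed, after time [n], by a trajectory in [B] is the
    integral over [A] of [Q (X n) B] under [P x] ([last_exit_shift]). Taking for
    [B] the trajectories that avoid [y0], this says that [Q] satisfies the
    last-exit identity for [phibr Q y0] and [y0]; it also gives the harmonicity of
    [phibr Q y0] outside of [y0].

    Two facts remain: [y0] is [Q x]-almost everywhere visited finitely often
    ([last_exit_io]), and [phibr Q y0 - phi] is bounded ([phibr_bound]), which
    makes [phibr Q y0] finite and unbounded. Both are sums over the times of visits
    and follow from one estimate on the chain: the mean number of visits to a
    point before another one is hit is bounded, uniformly in the starting point
    ([green_bound]). *)

(** * Events of the filtration, visits and local times *)

Section filtration.
Context {E : pointedType}.
Implicit Types (A : set (traj E)) (B : set E) (n m : nat) (y : E).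

Lemma Fn_sigma n : sigma_algebra setT (@Fn E n).
Proof. exact: smallest_sigma_algebra. Qed.

Lemma Fn0 n : @Fn E n set0.
Proof. by have [] := Fn_sigma n. Qed.

Lemma FnC n A : Fn n A -> Fn n (~` A).
Proof. by have [_ h _] := Fn_sigma n; move=> /h; rewrite setTD. Qed.

Lemma Fn_bigcup n (F : nat -> set (traj E)) :
  (forall i, Fn n (F i)) -> Fn n (\bigcup_i F i).
Proof. by have [_ _ h] := Fn_sigma n; exact: h. Qed.

Lemma FnT n : @Fn E n setT.
Proof. by rewrite -setC0; exact: FnC (@Fn0 n). Qed.

Lemma FnU n A A' : Fn n A -> Fn n A' -> Fn n (A `|` A').
Proof.
move=> FA FA'; rewrite -bigcup2E; apply: Fn_bigcup => -[|[|i]] //=.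
exact: Fn0.
Qed.

Lemma FnI n A A' : Fn n A -> Fn n A' -> Fn n (A `&` A').
Proof.
by move=> /FnC FA /FnC FA'; rewrite -[_ `&` _]setCK setCI; exact: FnC (FnU FA FA').
Qed.

Lemma Fn_X m n B : (m <= n)%N -> Fn n (X m @^-1` B).
Proof.
by move=> mn; apply: sub_sigma_algebra; exists m => //; exists B.
Qed.

Lemma Fn_le m n A : (m <= n)%N -> Fn m A -> Fn n A.
Proof.
move=> mn; apply: (smallest_sub (Fn_sigma n)) => _ [k /= km [B ->]].
exact: (Fn_X B (leq_trans km mn)).
Qed.

Lemma Fn_measurable n A : Fn n A -> measurable A.
Proof.
apply: (smallest_sub (@smallest_sigma_algebra _ _ _)) => _ [k /= km [B ->]].
exact: measurable_coord.
Qed.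

Lemma Fn_Lpre y n (N : set nat) : Fn n (Lpre y n @^-1` N).
Proof.
elim: n N => [|n IH] N.
  have -> : Lpre y 0 @^-1` N = if `[< N 0%N >] then setT else set0.
    apply/seteqP; rewrite /Lpre; split => w /=; rewrite big_ord0;
      by case: asboolP.
  by case: asboolP => _; [exact: FnT|exact: Fn0].
have -> : Lpre y n.+1 @^-1` N =
    (X n @^-1` [set y] `&` Lpre y n @^-1` [set k | N k.+1])
    `|` (X n @^-1` [set~ y] `&` Lpre y n @^-1` N).
  apply/seteqP; split => w /=; rewrite /Lpre big_ord_recr /=;
    have [->|/eqP Xy] := eqVneq; rewrite ?addn1 ?addn0.
  - by left.
  - by right.
  - by case=> -[].
  - by case=> -[].
by apply: FnU; apply: FnI; by [exact: Fn_X|exact: (Fn_le (leqnSn n))].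
Qed.

Definition tshift n (w : traj E) : traj E := fun k => w (n + k)%N.

Lemma Fn_tshift n m A : Fn m A -> Fn (n + m) (tshift n @^-1` A).
Proof.
apply: (@smallest_sub _ (sigma_algebra setT) _
  [set A | Fn (n + m) (tshift n @^-1` A)]) => [|_ [k /= km [B ->]]].
  split => /= [|A' FA|F FF].
  - by rewrite preimage_set0; exact: Fn0.
  - by rewrite setTD preimage_setC; exact: FnC.
  - by rewrite preimage_bigcup; exact: Fn_bigcup.
by apply: (@Fn_X (n + k) (n + m) B); rewrite leq_add2l.
Qed.

Lemma measurable_tshift n : measurable_fun setT (tshift n).
Proof.
move=> _ A mA; rewrite setTI; move: A mA.
apply: (@smallest_sub _ (sigma_algebra setT) _
  [set A | measurable (tshift n @^-1` A)]) => [|_ [k /= km [B ->]]].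
  split => /= [|A' FA|F FF].
  - by rewrite preimage_set0; exact: measurable0.
  - by rewrite setTD preimage_setC; exact: measurableC.
  - by rewrite preimage_bigcup; exact: bigcupT_measurable.
exact: (measurable_coord (n + k) B).
Qed.

Definition avoids_upto i N y : set (traj E) :=
  [set w | forall m, (i <= m < N)%N -> X m w <> y].

Lemma avoids_upto0 i y : avoids_upto i i y = setT.
Proof.
by apply/seteqP; split => // w _ m /andP[im mi]; move: (leq_trans mi im); rewrite ltnn.
Qed.

Lemma avoids_uptoS i N y : (i <= N)%N ->
  avoids_upto i N.+1 y = avoids_upto i N y `&` X N @^-1` [set~ y].
Proof.
move=> iN; apply/seteqP; split => w /=.
  move=> h; split => [m /andP[im mN]|]; apply: h.
    by rewrite im ltnW.
  by rewrite iN ltnSn.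
move=> [h hN] m /andP[im]; rewrite ltnS leq_eqVlt => /predU1P[->//|mN].
by apply: h; rewrite im.
Qed.

Lemma Fn_avoids_upto i N y : Fn N (avoids_upto i N y).
Proof.
have [Ni|iN] := leqP N i.
  rewrite (_ : avoids_upto i N y = setT); first exact: FnT.
  apply/seteqP; split => // w _ m /andP[im mi].
  by move: (leq_trans (leq_trans mi Ni) im); rewrite ltnn.
rewrite -(subnKC (ltnW iN)); elim: (N - i)%N => [|k IH].
  by rewrite addn0 avoids_upto0; exact: FnT.
rewrite addnS avoids_uptoS ?leq_addr//.
by apply: FnI; [exact: Fn_le IH|exact: Fn_X].
Qed.

Lemma avoids_split i N y : (i <= N)%N ->
  avoids i y = avoids_upto i N y `&` avoids N y.
Proof.
move=> iN; apply/seteqP; split => w /=.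
  by move=> h; split => [m /andP[im _]|m Nm]; apply: h => //; exact: leq_trans Nm.
move=> [h h'] m im; have [Nm|mN] := leqP N m; first exact: h'.
by apply: h; rewrite im.
Qed.

Lemma avoids_bigcap i y :
  avoids i y = \bigcap_k avoids_upto i (i + k) y.
Proof.
apply/seteqP; split => w /=.
  by move=> h k _ m /andP[im _]; exact: h.
move=> h m im; apply: (h (m.+1 - i)%N) => //.
by rewrite im subnKC ?leqnn// leqW.
Qed.

Lemma avoids_le i j y : (i <= j)%N -> avoids i y `<=` avoids j y.
Proof. by move=> ij w h m jm; apply: h; exact: leq_trans jm. Qed.

Lemma LpreS y n w : Lpre y n.+1 w = (Lpre y n w + (X n w == y))%N.
Proof. by rewrite /Lpre big_ord_recr. Qed.

Lemma Lpre_mono y n m w : (n <= m)%N -> (Lpre y n w <= Lpre y m w)%N.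
Proof.
move=> /subnKC <-; elim: (m - n)%N => [|k IH]; first by rewrite addn0.
by rewrite addnS LpreS; exact: leq_trans (leq_addr _ _).
Qed.

Lemma Lpre_avoids_upto i N y w : (i <= N)%N -> avoids_upto i N y w ->
  Lpre y N w = Lpre y i w.
Proof.
move=> /subnKC <-; elim: (N - i)%N => [|k IH]; first by rewrite addn0.
rewrite addnS avoids_uptoS ?leq_addr// => -[/IH <- /= /eqP wN].
by rewrite LpreS (negbTE wN) addn0.
Qed.

Lemma Lpre_avoids i N y w : (i <= N)%N -> avoids i y w ->
  Lpre y N w = Lpre y i w.
Proof. by move=> iN; rewrite (avoids_split _ iN) => -[/(Lpre_avoids_upto iN)]. Qed.

Definition infinitely_often y : set (traj E) := ~` \bigcup_n avoids n y.

Lemma measurable_io y : measurable (infinitely_often y).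
Proof.
by apply: measurableC; apply: bigcupT_measurable => n; exact: measurable_avoids.
Qed.

(** Since [Lpre y m] does not count time [m] itself, this is the event that
    the visit number [k+1] to [y] takes place at time [m]. *)
Definition visit y k m : set (traj E) :=
  [set w | Lpre y m w = k /\ X m w = y].

Lemma Fn_visit y k m : Fn m (visit y k m).
Proof.
rewrite (_ : visit y k m = Lpre y m @^-1` [set k] `&` X m @^-1` [set y])//.
by apply: FnI; [exact: Fn_Lpre|exact: Fn_X].
Qed.

Lemma visit_inj y k m m' w : visit y k m w -> visit y k m' w -> m = m'.
Proof.
wlog lemm : m m' / (m <= m')%N.
  by move=> H vm vm'; have [/H|/ltnW/H h] := leqP m m'; [exact|rewrite h].
move=> [Lm Xm] [Lm' _]; apply/eqP; rewrite eqn_leq lemm leqNgt; apply/negP => mm'.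
have := Lpre_mono y w mm'.
by rewrite LpreS Xm eqxx Lm Lm' addn1 ltnn.
Qed.

Lemma trivIset_visit y k : trivIset setT (visit y k).
Proof.
apply/trivIsetP => i j _ _ /eqP ij; apply/seteqP; split => // w [wi wj].
by apply: ij; exact: visit_inj wi wj.
Qed.

(** The local time grows by unit steps, and only at visits. *)
Lemma visit_between y k n d w : (Lpre y n w <= k)%N -> (k < Lpre y (n + d) w)%N ->
  exists m, visit y k (n + m) w.
Proof.
move=> Ln; elim: d => [|d IH]; first by rewrite addn0 ltnNge Ln.
rewrite addnS LpreS; case: eqP => [wy|_]; last by rewrite addn0 => /IH.
rewrite addn1 ltnS leq_eqVlt => /predU1P[kd|]; last exact: IH.
by exists d.
Qed.

Lemma io_unbounded y w n k : infinitely_often y w -> exists d, (k < Lpre y (n + d) w)%N.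
Proof.
move=> wio; elim: k => [|k [d kd]].
  have [m nm wm] : exists2 m, (n <= m)%N & X m w = y.
    apply: contrapT => nw; apply: wio; exists n => // m nm wm.
    by apply: nw; exists m.
  exists (m.+1 - n)%N; rewrite subnKC; last exact: leqW.
  by rewrite LpreS wm eqxx addn1.
have [m nm wm] : exists2 m, (n + d <= m)%N & X m w = y.
  apply: contrapT => nw; apply: wio; exists (n + d)%N => // m nm wm.
  by apply: nw; exists m.
exists (m.+1 - n)%N; rewrite subnKC; last first.
  by apply: leqW; exact: leq_trans (leq_addr _ _) nm.
by rewrite LpreS wm eqxx addn1 ltnS; exact: leq_trans (Lpre_mono y w nm).
Qed.

Lemma io_visit y k n w : infinitely_often y w -> (Lpre y n w <= k)%N ->
  exists m, visit y k (n + m) w.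
Proof. by move=> /(@io_unbounded y w n k)[d kd] nk; exact: visit_between kd. Qed.

(** Either [y] is not visited after time [n], or the last visit happens at a
    time [n + m]: the case distinction behind every last-exit decomposition. *)
Lemma last_visit n d y w : avoids (n + d) y w ->
  avoids n y w \/ exists2 m, X (n + m) w = y & avoids (n + m).+1 y w.
Proof.
elim: d => [|d IH]; first by rewrite addn0; left.
rewrite addnS => wd; have [wy|wy] := pselect (X (n + d) w = y).
  by right; exists d.
apply: IH => m; rewrite leq_eqVlt => /predU1P[<-//|]; exact: wd.
Qed.

End filtration.

(** * Measures and integrals on trajectories *)

Section coordinates.
Context {R : realType} {E : pointedType}.
Hypothesis hE : countable [set: E].
Implicit Types (mu nu : {measure set (traj E) -> \bar R}) (A B : set (traj E)).

Lemma measurable_X d (T : measurableType d) (f : E -> T) n :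
  measurable_fun [set: traj E] (fun w => f (X n w)).
Proof. by move=> _ B mB; rewrite setTI; exact: (measurable_coord n (f @^-1` B)). Qed.

Lemma measurable_Lpre d (T : measurableType d) (f : nat -> T) y n :
  measurable_fun [set: traj E] (fun w => f (Lpre y n w)).
Proof.
move=> _ B mB; rewrite setTI; exact: (Fn_measurable (@Fn_Lpre E y n (f @^-1` B))).
Qed.

Lemma integral_level_sum mu (g : traj E -> nat) A (f : traj E -> \bar R) :
  (forall k, measurable (g @^-1` [set k])) -> measurable A ->
  measurable_fun [set: traj E] f -> (forall w, 0 <= f w) ->
  \int[mu]_(w in A) f w = \sum_(k <oo) \int[mu]_(w in A `&` g @^-1` [set k]) f w.
Proof.
move=> mg mA mf f0.
have AE : A = \bigcup_k (A `&` g @^-1` [set k]).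
  by apply/seteqP; split => w; [exists (g w)|case=> k _ []].
rewrite [in LHS]AE ge0_integral_bigcup//.
- by move=> k; apply: measurableI.
- exact: measurable_funTS.
- apply/trivIsetP => i k _ _ /eqP ik.
  by apply/seteqP; split => // w [[_ /= wi] [_ /= wk]]; apply: ik; rewrite -wi.
Qed.

(** Countability of [E] enters here and only through this lemma: two integrals
    agree as soon as they agree on each value of one coordinate. The times of
    the coordinates may differ, which lets a time shift be absorbed. *)
Lemma integral_coord_ext mu nu (n m : nat) A B (f g : traj E -> \bar R) :
  measurable A -> measurable B ->
  measurable_fun [set: traj E] f -> measurable_fun [set: traj E] g ->
  (forall w, 0 <= f w) -> (forall w, 0 <= g w) ->
  (forall z, \int[mu]_(w in A `&` [set w | X n w = z]) f w =
             \int[nu]_(w in B `&` [set w | X m w = z]) g w) ->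
  \int[mu]_(w in A) f w = \int[nu]_(w in B) g w.
Proof.
move=> mA mB mf mg f0 g0 fg.
have [e /in2TT einj] := countable_injP _ hE.
have decomp (rho : {measure set (traj E) -> \bar R}) j D (h : traj E -> \bar R) :
    measurable D -> measurable_fun [set: traj E] h -> (forall w, 0 <= h w) ->
    \int[rho]_(w in D) h w =
    \sum_(k <oo) \int[rho]_(w in D `&` X j @^-1` (e @^-1` [set k])) h w.
  move=> mD mh h0; apply: (@integral_level_sum rho (e \o X j)) => // k.
  exact: (measurable_coord j (e @^-1` [set k])).
rewrite (decomp mu n A f)// (decomp nu m B g)//.
apply: eq_eseriesr => k _.
have [[z zk]|nz] := pselect (exists z, e z = k).
  have -> : e @^-1` [set k] = [set z].
    by apply/seteqP; split => [z'|z' ->//]; rewrite /= -zk => /einj.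
  exact: fg.
have -> : e @^-1` [set k] = set0.
  by apply/seteqP; split => // z' /= zk; apply: nz; exists z'.
by rewrite !preimage_set0 !setI0 !integral_set0.
Qed.

Lemma measure_coord_ext mu nu n m A B (c : \bar R) :
  measurable A -> measurable B -> 0 <= c ->
  (forall z, mu (A `&` [set w | X n w = z]) =
             c * nu (B `&` [set w | X m w = z])) ->
  mu A = c * nu B.
Proof.
move=> mA mB c0 h.
have -> : mu A = \int[mu]_(w in A) cst 1 w by rewrite integral_cst// mul1e.
have -> : c * nu B = \int[nu]_(w in B) cst c w by rewrite integral_cst.
apply: (@integral_coord_ext mu nu n m) => // z.
rewrite !integral_cst ?mul1e//; apply: measurableI => //.
  exact: (measurable_coord m [set z]).
exact: (measurable_coord n [set z]).
Qed.

Lemma measure_setI_conull mu A N : measurable A -> measurable N ->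
  mu (~` N) = 0 -> mu (A `&` N) = mu A.
Proof.
move=> mA mN N0; rewrite [RHS](measureDI mu mA mN).
rewrite (@subset_measure0 _ _ _ mu (A `\` N) (~` N)) ?add0e//.
  exact: measurableD.
exact: measurableC.
Qed.

End coordinates.

Section shifted_restriction.
Context {R : realType} {E : pointedType}.
Variables (mu : {measure set (traj E) -> \bar R}) (A : set (traj E)) (n : nat).
Hypothesis mA : measurable A.

(** The law of the future after time [n], on the event [A]: the Markov
    properties compare it with a multiple of the law started from a point. The
    measurability of [A] is an argument so that the measure structure can be
    inferred. *)
Definition restr_tshift of measurable A :=
  fun B : set (traj E) => mu (A `&` tshift n @^-1` B).
Local Notation nu := (restr_tshift mA).

Let mshift (B : set (traj E)) : measurable B -> measurable (tshift n @^-1` B).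
Proof. by move=> mB; rewrite -[X in measurable X]setTI; exact: measurable_tshift. Qed.

Let nu0 : nu set0 = 0.
Proof. by rewrite /nu preimage_set0 setI0 measure0. Qed.

Let nu_ge0 B : 0 <= nu B.
Proof. exact: measure_ge0. Qed.

Let nu_sigma_additive : semi_sigma_additive nu.
Proof.
move=> F mF tF mUF; rewrite /nu preimage_bigcup setI_bigcupr.
apply: measure_semi_sigma_additive.
- by move=> i; apply: measurableI => //; exact: mshift.
- apply/trivIsetP => /= i j _ _ ij; rewrite setIACA setIid -preimage_setI.
  by move/trivIsetP : tF => /(_ _ _ _ _ ij) ->//; rewrite preimage_set0 setI0.
- apply: bigcupT_measurable => i; apply: measurableI => //; exact: mshift.
Qed.

HB.instance Definition _ := isMeasure.Build _ _ _ nu nu0 nu_ge0 nu_sigma_additive.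

End shifted_restriction.

(** * The Markov property *)

Section markov.
Context {R : realType} {E : pointedType}.
Hypothesis hE : countable [set: E].
Variables (p : E -> E -> R) (P : E -> probability (traj E) R).
Hypothesis hP : markov_chain p P.
Implicit Types (A B : set (traj E)) (x y z : E).

Lemma prob_start x A : measurable A -> P x (A `&` [set w | X 0 w = x]) = P x A.
Proof.
move=> mA; have mx : measurable [set w : traj E | X 0 w = x].
  exact: (measurable_coord 0 [set x]).
apply: measure_setI_conull => //.
transitivity (1 - P x [set w | X 0 w = x]); first exact: probability_setC.
by rewrite (mc_start hP) subee.
Qed.

Lemma prob_next y z : P y [set w | X 1 w = z] = (p y z)%:E.
Proof.
have := @mc_step _ _ _ _ hP y 0 setT y z (@FnT _ _).
rewrite !setTI (mc_start hP) mul1e => <-.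
by rewrite setIC prob_start//; exact: (measurable_coord 1 [set z]).
Qed.

(** A generating pi-system whose members unfold one coordinate at a time, so
    that the one-step transition rule propagates by induction. *)
Definition cylinder m (Bs : nat -> set E) : set (traj E) :=
  [set w | forall i, (i < m)%N -> Bs i (X i w)].

Lemma cylinderS m Bs :
  cylinder m.+1 Bs = X 0 @^-1` (Bs 0%N) `&` tshift 1 @^-1` cylinder m (Bs \o S).
Proof.
apply/seteqP; split => w /=.
  by move=> h; split => [|i im]; [exact: (h 0%N)|exact: (h i.+1)].
by move=> [h0 h] [|i] //= im; exact: h.
Qed.

Lemma measurable_cylinder m Bs : measurable (cylinder m Bs).
Proof.
elim: m Bs => [|m IH] Bs.
  by rewrite (_ : cylinder 0 Bs = setT)//; apply/seteqP; split.
rewrite cylinderS; apply: measurableI; first exact: measurable_coord.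
by rewrite -[X in measurable X]setTI; exact: measurable_tshift.
Qed.

Lemma markov_cylinder m Bs x n A y : Fn n A ->
  P x (A `&` [set w | X n w = y] `&` tshift n @^-1` cylinder m Bs) =
  P x (A `&` [set w | X n w = y]) * P y (cylinder m Bs).
Proof.
elim: m Bs x n A y => [|m IH] Bs x n A y FA.
  rewrite (_ : cylinder 0 Bs = setT); last by apply/seteqP; split.
  by rewrite preimage_setT setIT probability_setT mule1.
have FAy : Fn n (A `&` [set w | X n w = y]).
  by apply: FnI => //; exact: (@Fn_X _ n n [set y]).
have mC k (C : set (traj E)) : measurable C -> measurable (tshift k @^-1` C).
  by move=> ? ; rewrite -[X in measurable X]setTI; exact: measurable_tshift.
set A' := A `&` _ in FAy *; set D := cylinder _ _.
have mD : measurable D by exact: measurable_cylinder.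
have mA' : measurable A' by exact: Fn_measurable FAy.
suff key z : P x (A' `&` tshift n @^-1` D `&` [set w | X n.+1 w = z]) =
    P x A' * P y (D `&` [set w | X 1 w = z]).
  apply: (@measure_coord_ext _ _ hE _ _ n.+1 1) => //.
  by apply: measurableI => //; exact: mC.
pose C := cylinder m (Bs \o S).
have -> : P y (D `&` [set w | X 1 w = z]) =
    P y (D `&` [set w | X 1 w = z] `&` [set w | X 0 w = y]).
  rewrite prob_start//; apply: measurableI => //.
  exact: (measurable_coord 1 [set z]).
have [By|nBy] := pselect (Bs 0%N y); last first.
  rewrite (_ : _ `&` [set w | X n.+1 w = z] = set0); last first.
    apply/seteqP; split => // w [[[_ /= wy] Dw] _]; apply: nBy.
    have := Dw 0%N isT; rewrite /X /tshift addn0.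
    by rewrite -[w n]/(X n w) wy.
  rewrite (_ : _ `&` [set w | X 0 w = y] = set0); last first.
    apply/seteqP; split => // w [[Dw _] /= wy]; apply: nBy.
    by have := Dw 0%N isT; rewrite wy.
  by rewrite !measure0 mule0.
have -> : A' `&` tshift n @^-1` D `&` [set w | X n.+1 w = z] =
    A' `&` [set w | X n.+1 w = z] `&` tshift n.+1 @^-1` C.
  have sC w : tshift n.+1 w = tshift 1 (tshift n w).
    by apply/funext => k; rewrite /tshift addSnnS.
  rewrite /D cylinderS; apply/seteqP; split => w /=; rewrite sC.
    by move=> [[? [? ?]] ?].
  move=> [[Aw ?] ?]; split => //; split => //; split => //.
  have [_ /= wy] := Aw.
  by rewrite /X /tshift addn0 -[w n]/(X n w) wy.
have -> : D `&` [set w | X 1 w = z] `&` [set w | X 0 w = y] =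
    [set w | X 0 w = y] `&` [set w | X 1 w = z] `&` tshift 1 @^-1` C.
  rewrite /D cylinderS; apply/seteqP; split => w /=.
    by move=> [[[? ?] ?] ?].
  by move=> [[-> ->] ?].
rewrite (IH _ x n.+1 _ z (Fn_le (leqnSn n) FAy)) (mc_step hP)//.
have F0 : Fn 0 [set w : traj E | X 0 w = y] by exact: (@Fn_X _ 0 0 [set y]).
rewrite (IH _ y 1%N _ z (Fn_le (leqnSn 0) F0)).
have -> : P y ([set w | X 0 w = y] `&` [set w | X 1 w = z]) = (p y z)%:E.
  by rewrite setIC prob_start ?prob_next//; exact: (measurable_coord 1 [set z]).
by rewrite muleA.
Qed.

(** Cylinders satisfy the identity, and both sides are finite measures in
    [B]. *)
Theorem markov_property x n A y B : Fn n A -> measurable B ->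
  P x (A `&` [set w | X n w = y] `&` tshift n @^-1` B) =
  P x (A `&` [set w | X n w = y]) * P y B.
Proof.
move=> FA mB.
have mA' : measurable (A `&` [set w | X n w = y]).
  by apply: measurableI; [exact: Fn_measurable FA|exact: (measurable_coord n [set y])].
set A' := A `&` _ in mA' *.
have A'fin : P x A' \is a fin_num by rewrite fin_num_measure.
pose c : {nonneg R} := NngNum (fine_ge0 (measure_ge0 (P x) A')).
transitivity (mscale c (P y) B); last by rewrite /mscale/= fineK.
rewrite -[LHS]/(restr_tshift (P x) n mA' B).
pose G : set (set (traj E)) := [set C | exists m, exists Bs, C = cylinder m Bs].
apply: (measure_unique G (fun=> setT)) => //.
- apply/seteqP; split; last first.
    apply: smallest_sub => [|_ [m [Bs ->]]]; first exact: sigma_algebra_measurable.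
    exact: measurable_cylinder.
  apply: smallest_sub => [|_ [n0 _ [B0 ->]]]; first exact: smallest_sigma_algebra.
  apply: sub_sigma_algebra; exists n0.+1.
  exists (fun i => if i == n0 then B0 else setT).
  apply/seteqP; split => w /=.
    by move=> wB i _; case: eqP => // ->.
  by move=> /(_ n0 (ltnSn n0)); rewrite eqxx.
- move=> _ _ [m [Bs ->]] [k [Cs ->]]; exists (maxn m k).
  exists (fun i => (if (i < m)%N then Bs i else setT) `&`
                   (if (i < k)%N then Cs i else setT)).
  apply/seteqP; split => w /=.
    by move=> [hB hC] i _; split; case: ifPn => // im; [exact: hB|exact: hC].
  move=> h; split => i ik.
    by have := h i; rewrite leq_max ik => /(_ isT)[].
  by have := h i; rewrite leq_max ik orbT => /(_ isT)[].
- by move=> i; exists 0%N; exists (fun=> setT); apply/seteqP; split.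
- by rewrite bigcup_const.
- move=> _ [m [Bs ->]]; rewrite /= /restr_tshift /mscale /= fineK//.
  exact: markov_cylinder.
- move=> k; rewrite /restr_tshift /= preimage_setT setIT.
  by rewrite ltey_eq A'fin.
Qed.

Lemma integral_next (f : E -> \bar R) x n A : (forall y, 0 <= f y) -> Fn n A ->
  \int[P x]_(w in A) f (X n.+1 w) = \int[P x]_(w in A) Enext P f (X n w).
Proof.
move=> f0 FA; have mA := Fn_measurable FA.
have e0 y : 0 <= Enext P f y by apply: integral_ge0.
apply: (@integral_coord_ext _ _ hE _ _ n n) => //.
- exact: measurable_X.
- exact: measurable_X.
move=> y.
have FAy : Fn n (A `&` [set w | X n w = y]).
  by apply: FnI => //; exact: (@Fn_X _ n n [set y]).
have mAy := Fn_measurable FAy.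
rewrite [RHS](_ : _ =
  \int[P x]_(w in A `&` [set w | X n w = y]) cst (Enext P f y) w); last first.
  by apply: eq_integral => w /[!inE] -[_ /= ->].
rewrite integral_cst//.
have A'fin : P x (A `&` [set w | X n w = y]) \is a fin_num.
  by rewrite fin_num_measure.
pose c : {nonneg R} :=
  NngNum (fine_ge0 (measure_ge0 (P x) (A `&` [set w | X n w = y]))).
transitivity (\int[mscale c (P y)]_w f (X 1 w)); last first.
  rewrite ge0_integral_mscale//=; last exact: measurable_X.
  by rewrite fineK// muleC.
apply: (@integral_coord_ext _ _ hE _ _ n.+1 1) => //.
- exact: measurable_X.
- exact: measurable_X.
move=> z; have m1z : measurable [set w : traj E | X 1 w = z].
  exact: (measurable_coord 1 [set z]).
rewrite setTI.
transitivity (\int[P x]_(w in A `&` [set w | X n w = y] `&` [set w | X n.+1 w = z])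
  cst (f z) w).
  by apply: eq_integral => w /[!inE] -[_ /= ->].
transitivity (\int[mscale c (P y)]_(w in [set w | X 1 w = z]) cst (f z) w); last first.
  by apply: eq_integral => w /[!inE] /= ->.
rewrite !integral_cst//; last first.
  by apply: measurableI => //; exact: (measurable_coord n.+1 [set z]).
transitivity (f z * (P x (A `&` [set w | X n w = y]) * (p y z)%:E)).
  by congr (_ * _); exact: (mc_step hP).
by rewrite /= /mscale /= fineK// prob_next.
Qed.

Lemma integral_const_X (f : E -> \bar R) x n A y : (forall y, 0 <= f y) -> 
  measurable A -> A `<=` [set w | X n w = y] ->
  \int[P x]_(w in A) f (X n w) = f y * P x A.
Proof.
move=> f0 mA Ay.
rewrite (_ : \int[P x]_(w in A) _ = \int[P x]_(w in A) cst (f y) w).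
  by rewrite integral_cst.
by apply: eq_integral => w /[!inE] /Ay /= ->.
Qed.

End markov.

(** * Recurrence, and a bound on the Green function killed at a point *)

Section recurrence.
Context {R : realType} {E : pointedType}.
Hypothesis hE : countable [set: E].
Variables (p : E -> E -> R) (P : E -> probability (traj E) R).
Hypothesis hP : markov_chain p P.
Hypothesis hirr : irreducible_chain P.
Implicit Types (A B : set (traj E)) (x y z a : E).

Lemma avoids_tshift n i y : tshift n @^-1` avoids i y = avoids (n + i) y.
Proof.
apply/seteqP; split => w /=; last first.
  by move=> h m im; apply: (h (n + m)%N); rewrite leq_add2l.
move=> h m nim; have nm : (n <= m)%N by exact: leq_trans (leq_addr _ _) nim.
by have := h (m - n)%N; rewrite /X /tshift subnKC//; apply; rewrite leq_subRL.
Qed.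

(** From [z], the last visit to [z] cannot happen at any finite time, since
    it would be followed by a trajectory that never returns. As [z] leads to
    every [y], the chain started from [y] cannot miss [z] either. *)
Lemma prob_avoids (hrec : recurrent_chain P) x n z : P x (avoids n z) = 0.
Proof.
have mX m (y : E) : measurable [set w : traj E | X m w = y].
  exact: (measurable_coord m [set y]).
have noreturn : P z (avoids 1 z) = 0.
  have -> : avoids 1 z = ~` [set w : traj E | exists2 n, (1 <= n)%N & X n w = z].
    apply/seteqP; split => w /=.
      by move=> h [m m1]; exact: h.
    by move=> h m m1 wz; apply: h; exists m.
  rewrite [LHS]probability_setC ?hrec ?subee//.
  rewrite (_ : [set w | _] = \bigcup_(m in [set m | (1 <= m)%N]) [set w | X m w = z]) //.
  by apply: bigcup_measurable.
have avoids_z m : P z (avoids m z) = 0.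
  elim: m => [|m IH].
    apply: (subset_measure0 _ _ _ noreturn); [exact: measurable_avoids|exact: measurable_avoids|].
    exact: avoids_le.
  have ret0 : P z ([set w | X m w = z] `&` tshift m @^-1` avoids 1 z) = 0.
    rewrite -[X in X `&` _]setTI.
    rewrite (markov_property hE hP); [|exact: FnT|exact: measurable_avoids].
    by rewrite noreturn mule0.
  have mret : measurable ([set w | X m w = z] `&` tshift m @^-1` avoids 1 z).
    by apply: measurableI => //; rewrite avoids_tshift; exact: measurable_avoids.
  apply: (@subset_measure0 _ _ _ (P z) _
    (avoids m z `|` ([set w | X m w = z] `&` tshift m @^-1` avoids 1 z))).
  - exact: measurable_avoids.
  - by apply: measurableU => //; exact: measurable_avoids.
  - move=> w wS; rewrite avoids_tshift addn1.
    have [wz|wz] := pselect (X m w = z); first by right.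
    by left=> k; rewrite leq_eqVlt => /predU1P[<-//|]; exact: wS.
  - by rewrite [LHS]measureU0//; exact: measurable_avoids.
have avoids0 y : P y (avoids 0 z) = 0.
  have [m Pm] := hirr z y.
  have : P z ([set w | X m w = y] `&` tshift m @^-1` avoids 0 z) = 0.
    apply: (@subset_measure0 _ _ _ (P z) _ (avoids m z)) => //.
    - by apply: measurableI => //; rewrite avoids_tshift; exact: measurable_avoids.
    - exact: measurable_avoids.
    - by rewrite avoids_tshift addn0 => w [].
    - exact: avoids_z.
  have := markov_property hE hP z y (@FnT _ m) (measurable_avoids 0 z).
  rewrite !setTI => -> /eqP; rewrite mule_eq0 => /orP[|/eqP//].
  by move=> /eqP P0; rewrite P0 ltxx in Pm.
rewrite -[RHS](mul0e (P x (avoids n z))).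
apply: (@measure_coord_ext _ _ hE _ _ n n) => //;
  [exact: measurable_avoids|exact: measurable_avoids|].
move=> y; rewrite mul0e setIC -[X in X `&` _]setTI.
have -> : avoids n z = tshift n @^-1` avoids 0 z by rewrite avoids_tshift addn0.
transitivity (P x (setT `&` [set w | X n w = y]) * P y (avoids 0 z)).
  by apply: (markov_property hE hP); [exact: FnT|exact: measurable_avoids].
by rewrite avoids0 mule0.
Qed.

(** Telescoping with step [L]: only the first [L] terms survive. *)
Lemma sum_shift_le (u : nat -> R) M L : (forall k, (0 <= u k <= 1)%R) ->
  (\sum_(k < M) (u k - u (k + L)%N) <= L%:R)%R.
Proof.
move=> u01; elim: L => [|L IH].
  by rewrite big1// => k _; rewrite addn0 subrr.
rewrite (eq_bigr (fun k : 'I_M =>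
  (u k - u (k + L)%N) + (u (k + L)%N - u (k + L).+1)))%R; last first.
  by move=> k _; rewrite addnS addrA subrK.
rewrite big_split/= -natr1 lerD//.
have -> : (\sum_(k < M) (u (k + L)%N - u (k + L).+1) = u L - u (M + L)%N)%R.
  elim: M {IH} => [|M IH]; first by rewrite big_ord0 subrr.
  by rewrite big_ord_recr /= IH addrA subrK addSn.
have /andP[_ uL] := u01 L; have /andP[uM _] := u01 (M + L)%N.
by rewrite lerBlDr; exact: ler_wpDr.
Qed.

(** The mean number of visits to [a] before hitting [z] is bounded uniformly
    in the starting point and in the time [n] from which hits are recorded. If
    [a] leads to [z] in [N] steps with probability [d], then [d] times the
    probability to be in [a] at time [n + k], with [z] not hit yet, is at most
    the probability that [z] is first hit between times [n + k] and
    [n + k + N]; these events overlap at most [N + 1] times. *)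
Lemma green_bound a z : exists2 C : R, (0 <= C)%R & forall x n,
  \sum_(k <oo) P x (avoids_upto n (n + k) z `&` [set w | X (n + k) w = a]) <= C%:E.
Proof.
have [N PN] := hirr a z.
pose d := fine (P a [set w | X N w = z]).
have mX m (y : E) : measurable [set w : traj E | X m w = y].
  exact: (measurable_coord m [set y]).
have Pfin x B : measurable B -> P x B \is a fin_num by move=> ?; rewrite fin_num_measure.
have d0 : (0 < d)%R by rewrite fine_gt0// PN ltey_eq Pfin//; exact: mX.
exists (N.+1%:R / d)%R; first by rewrite divr_ge0// ltW.
move=> x n.
have mU k : measurable (avoids_upto n (n + k) z).
  exact: Fn_measurable (@Fn_avoids_upto E n (n + k) z).
pose u k := fine (P x (avoids_upto n (n + k) z)).
set V := fun k => avoids_upto n (n + k) z `&` [set w | X (n + k) w = a].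
have mV k : measurable (V k) by apply: measurableI.
have u01 k : (0 <= u k <= 1)%R.
  by rewrite fine_ge0//= -lee_fin fineK ?Pfin// probability_le1.
have step k : (fine (P x (V k)) * d <= u k - u (k + N.+1)%N)%R.
  have mVz : measurable (V k `&` tshift (n + k) @^-1` [set w | X N w = z]).
    by apply: measurableI => //; exact: (mX (n + k + N)%N).
  have : P x (V k) * P a [set w | X N w = z] <=
      P x (avoids_upto n (n + k) z `\` avoids_upto n (n + (k + N.+1)) z).
    rewrite -(markov_property hE hP)//; last exact: Fn_avoids_upto.
    apply: le_measure; rewrite ?inE//; first exact: measurableD.
    move=> w [[wu _] wz]; split => // wu'; apply: (wu' (n + k + N)%N) => //.
    by rewrite -addnA leq_addr/= !addnS !addnA ltnSn.
  have -> : P x (avoids_upto n (n + k) z `\` avoids_upto n (n + (k + N.+1)) z) =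
      P x (avoids_upto n (n + k) z) - P x (avoids_upto n (n + (k + N.+1)) z).
    rewrite [LHS]measureD//; last by rewrite ltey_eq Pfin.
    rewrite setIidr//.
    move=> w h m /andP[nm mk]; apply: h; rewrite nm (leq_trans mk)//.
    by rewrite leq_add2l leq_addr.
  rewrite -(fineK (Pfin x _ (mV k))) -(fineK (Pfin a _ (mX N z))).
  rewrite -(fineK (Pfin x _ (mU k))) -(fineK (Pfin x _ (mU (k + N.+1)%N))).
  by rewrite -EFinM -EFinB lee_fin.
apply: lime_le; first by apply: is_cvg_nneseries.
apply: nearW => M.
rewrite big_mkord (eq_bigr (fun k : 'I_M => (fine (P x (V k)))%:E)); last first.
  by move=> k _; rewrite fineK// Pfin.
rewrite sumEFin lee_fin ler_pdivlMr// mulr_suml.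
by apply: le_trans (sum_shift_le M N.+1 u01); apply: ler_sum => k _; exact: step.
Qed.

End recurrence.

(** * Total local time *)

Section total_local_time.
Context {R : realType} {E : pointedType}.
Implicit Types (y : E) (w : traj E).

Lemma limn_eventually (u : nat -> \bar R) n l :
  (forall m, (n <= m)%N -> u m = l) -> limn u = l.
Proof.
move=> ul; apply: lim_near_cst => //; exists n => // m /= nm; exact: ul.
Qed.

Lemma Loo_avoids n y w : avoids n y w -> Loo y w = (Lpre y n w)%:R%:E :> \bar R.
Proof. by move=> wn; apply: (@limn_eventually _ n) => m nm; rewrite (Lpre_avoids nm wn). Qed.

Lemma rNLoo_avoids (r : R) n y w : avoids n y w -> rNLoo r y w = (r ^- Lpre y n w)%:E.
Proof. by move=> wn; apply: (@limn_eventually _ n) => m nm; rewrite (Lpre_avoids nm wn). Qed.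

Lemma Loo_io y w (k : nat) : infinitely_often y w -> Loo y w <> k%:R%:E :> \bar R.
Proof.
move=> wio; apply/eqP; rewrite gt_eqF//.
have [d kd] := io_unbounded 0 k wio.
have ndL : nondecreasing_seq (fun n => (Lpre y n w)%:R%:E : \bar R).
  by move=> m n mn; rewrite lee_fin ler_nat Lpre_mono.
rewrite /Loo (cvg_lim _ (ereal_nondecreasing_cvgn ndL))//.
apply: (@lt_le_trans _ _ (Lpre y d w)%:R%:E); first by rewrite lte_fin ltr_nat.
by apply: ereal_sup_ubound; exists d.
Qed.

Lemma rNLoo_cvg (r : R) y w : (0 < r < 1)%R ->
  (fun n => (r ^- Lpre y n w)%:E) @ \oo --> rNLoo r y w.
Proof.
move=> /andP[r0 r1].
apply: ereal_nondecreasing_is_cvgn => m n mn.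
rewrite lee_fin lef_pV2 ?posrE ?exprn_gt0//.
by rewrite ler_wiXn2l ?Lpre_mono// ltW.
Qed.

Lemma rNLoo_ge0 (r : R) y w : (0 < r < 1)%R -> 0 <= rNLoo r y w.
Proof.
move=> r01; apply: lime_ge; first by apply/cvg_ex; exists (rNLoo r y w); exact: rNLoo_cvg.
by apply: nearW => n; rewrite lee_fin invr_ge0 exprn_ge0//; case/andP: r01 => /ltW.
Qed.

Lemma measurable_rNLoo (r : R) y : (0 < r < 1)%R ->
  measurable_fun [set: traj E] (rNLoo r y).
Proof.
move=> r01; apply: (@emeasurable_fun_cvg _ _ _ _ (fun n w => (r ^- Lpre y n w)%:E)).
  move=> n; exact: (measurable_Lpre (fun k => (r ^- k)%:E)).
by move=> w _; exact: rNLoo_cvg.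
Qed.

Definition total_visits y (k : nat) : set (traj E) :=
  [set w | Loo y w = k%:R%:E :> \bar R].

Lemma total_visits_avoids n y k : 
  total_visits y k `&` avoids n y = Lpre y n @^-1` [set k] `&` avoids n y.
Proof.
apply/seteqP; split => w [+ wn]; rewrite /total_visits /= (Loo_avoids wn).
  by move=> [/eqP]; rewrite eqr_nat => /eqP.
by move=> ->.
Qed.

(** Last-exit decomposition seen from time [n]: the last visit is before
    time [n], or at a time [n + m]. *)
Lemma total_visitsE n y k :
  total_visits y k = Lpre y n @^-1` [set k] `&` avoids n y `|`
    \bigcup_m (Lpre y (n + m).+1 @^-1` [set k] `&` [set w | X (n + m) w = y] `&`
               avoids (n + m).+1 y).
Proof.
apply/seteqP; split => w.
  move=> wk.
  have [N _ wN] : (\bigcup_n avoids n y) w.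
    by apply: contrapT => wio; exact: (Loo_io wio wk).
  have wnN : avoids (n + N) y w by apply: avoids_le wN; exact: leq_addl.
  have [wn|[m wm wm']] := last_visit wnN.
    by left; rewrite -total_visits_avoids.
  right; exists m => //; split => //; split => //.
  by have [] : (Lpre y (n + m).+1 @^-1` [set k] `&` avoids (n + m).+1 y) w
     by rewrite -total_visits_avoids.
move=> [|[m _ [[Lm _] wm]]].
  by rewrite -total_visits_avoids => -[].
suff [] : (total_visits y k `&` avoids (n + m).+1 y) w by [].
by rewrite total_visits_avoids.
Qed.

Lemma measurable_total_visits y k : measurable (total_visits y k).
Proof.
rewrite (total_visitsE 0); apply: measurableU.
  by apply: measurableI; [exact: Fn_measurable (@Fn_Lpre E y 0 _)|exact: measurable_avoids].
apply: bigcupT_measurable => m; apply: measurableI; last exact: measurable_avoids.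
apply: measurableI; first exact: Fn_measurable (@Fn_Lpre E y _ _).
exact: (measurable_coord _ [set y]).
Qed.

Lemma trivIset_total_visits y A : trivIset setT (fun k => A `&` total_visits y k).
Proof.
apply/trivIsetP => i j _ _ /eqP ij; apply/seteqP; split => // w [[_ wi] [_ wj]].
apply: ij; move: wi; rewrite /total_visits /= wj => -[/eqP].
by rewrite eqr_nat => /eqP.
Qed.

Lemma setC_infinitely_often y : ~` infinitely_often y = \bigcup_k total_visits y k.
Proof.
apply/seteqP; split => w; rewrite /infinitely_often setCK.
  by move=> [n _ wn]; exists (Lpre y n w) => //; exact: Loo_avoids.
by move=> [k _ wk]; apply: contrapT => wio; exact: (Loo_io wio wk).
Qed.

Lemma total_visits0 y : total_visits y 0 = avoids 0 y.
Proof.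
rewrite (total_visitsE 0); apply/seteqP; split => w.
  move=> [[]//|[m _ [[/= + wm] _]]].
  by rewrite LpreS add0n in wm *; rewrite wm eqxx addn1.
by left; split => //; rewrite /= /Lpre big_ord0.
Qed.

End total_local_time.
Arguments total_visits R {E} y k.

(** * Last-exit families *)

Section last_exit.
Context {R : realType} {E : pointedType}.
Hypothesis hE : countable [set: E].
Variables (p : E -> E -> R) (P : E -> probability (traj E) R).
Hypothesis hP : markov_chain p P.
Hypothesis hfin : finite_branching p.
Hypothesis hirr : irreducible_chain P.
Hypothesis hrec : recurrent_chain P.
Implicit Types (A B : set (traj E)) (x y z : E) (phi : E -> R).

(** The parameter [r] has disappeared: this is the description of the family
    of measures attached to [phi] and [z] on which everything below rests. *)
Definition last_exit_family phi z (Q : E -> {measure set (traj E) -> \bar R}) :=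
  forall x,
    (forall n A, Fn n A ->
       Q x (A `&` avoids n z) = \int[P x]_(w in A) (phi (X n w))%:E) /\
    Q x (infinitely_often z) = 0.

Lemma integral_cstP x A (r : \bar R) : measurable A ->
  \int[P x]_(w in A) cst r w = r * P x A.
Proof. by move=> mA; exact: integral_cst. Qed.

Lemma integral_prob_cst x (r : \bar R) : \int[P x]_w cst r w = r.
Proof.
by rewrite integral_cstP// probability_setT mule1.
Qed.

(** By finite branching, [phi (X 1)] is almost surely bounded. *)
Lemma Enext_fin phi y : (forall x, (0 <= phi x)%R) ->
  Enext P (EFin \o phi) y \is a fin_num.
Proof.
move=> phi0.
have mX (B : set E) : measurable [set w : traj E | B (X 1 w)] by exact: (measurable_coord 1 B).
have /finite_seqP[s sB] := hfin y.
have out0 : P y [set w | (~` [set z | (0 < p y z)%R]) (X 1 w)] = 0.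
  rewrite -[RHS](mul0e (P y setT)).
  apply: (@measure_coord_ext _ _ hE _ _ 1 1) => // z; rewrite mul0e.
  have [pz|pz] := pselect (0 < p y z)%R.
    rewrite (_ : _ `&` _ = set0) ?measure0//.
    by apply/seteqP; split => // w [/= + wz]; rewrite wz.
  apply: (@subset_measure0 _ _ _ (P y) _ [set w | X 1 w = z]).
  - by apply: measurableI; [exact: mX|exact: (mX [set z])].
  - exact: (mX [set z]).
  - by move=> w [].
  - rewrite [LHS](prob_next hP); congr (_%:E); apply/eqP.
    by rewrite eq_le (mc_ge0 hP) andbT leNgt; apply/negP.
rewrite ge0_fin_numE; last by apply: integral_ge0 => w _; rewrite lee_fin.
apply: (@le_lt_trans _ _ (\int[P y]_w cst (\sum_(z <- s) phi z)%:E w)).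
  apply: ae_ge0_le_integral => //.
  - by move=> w _; rewrite lee_fin.
  - exact: measurable_X.
  - by move=> w _; rewrite lee_fin sumr_ge0.
  exists [set w | (~` [set z | (0 < p y z)%R]) (X 1 w)]; split; [exact: mX|exact: out0|].
  move=> w /= nw pw; apply: nw => _; rewrite lee_fin.
  have ws : X 1 w \in s by have : [set` s] (X 1 w) by rewrite -sB.
  rewrite (big_rem _ ws)/= lerDl sumr_ge0//.
by rewrite integral_prob_cst ltry.
Qed.

Lemma integral_start (f : E -> \bar R) x A : (forall y, 0 <= f y) -> measurable A ->
  \int[P x]_(w in A) f (X 0 w) = f x * P x A.
Proof.
move=> f0 mA; rewrite -integral_cstP//.
apply: (@integral_coord_ext _ _ hE _ _ 0 0) => //;
  [exact: measurable_X|by move=> w; exact: f0|].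
move=> y.
have mAy : measurable (A `&` [set w | X 0 w = y]).
  by apply: measurableI => //; exact: (measurable_coord 0 [set y]).
rewrite (@integral_const_X _ _ P f x 0 _ y)//.
rewrite integral_cstP//; have [->//|/eqP yx] := eqVneq y x.
suff -> : P x (A `&` [set w | X 0 w = y]) = 0 by rewrite !mule0.
rewrite -(prob_start hP)// (_ : _ `&` _ = set0) ?measure0//.
by apply/seteqP; split => // w [[_ /= wy] /= wx]; apply: yx; rewrite -wy.
Qed.

Section admissible_function.
Variables (phi : E -> R) (z : E).
Hypothesis hphi : admissible P phi z.
Local Notation c := (fine (Enext P (EFin \o phi) z)).

Let phi_ge0 w n : 0 <= (phi (X n w) : R)%:E.
Proof. by rewrite lee_fin (adm_ge0 hphi). Qed.
Let mphi n : measurable_fun [set: traj E] (fun w => (phi (X n w))%:E).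
Proof. exact: (measurable_X (fun x => (phi x)%:E)). Qed.
Let mX n y : measurable [set w : traj E | X n w = y].
Proof. exact: (measurable_coord n [set y]). Qed.
Let c_fin : c%:E = Enext P (EFin \o phi) z.
Proof. by rewrite fineK// Enext_fin//; exact: adm_ge0 hphi. Qed.
Let c_ge0 : (0 <= c)%R.
Proof. by rewrite fine_ge0// integral_ge0// => w _; exact: phi_ge0. Qed.

(** The mean of [phi (X n)] grows by at most [Enext phi z] at each step. *)
Lemma integral_phi_fin x n : \int[P x]_w (phi (X n w))%:E < +oo.
Proof.
elim: n => [|n IH].
  rewrite (integral_start (f := EFin \o phi))//=.
    by rewrite probability_setT mule1 ltry.
  by move=> y; rewrite lee_fin (adm_ge0 hphi).
rewrite (integral_next hE hP (f := EFin \o phi)); last 2 first.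
- by move=> y; rewrite lee_fin (adm_ge0 hphi).
- exact: FnT.
apply: (@le_lt_trans _ _ (\int[P x]_w ((phi (X n w))%:E + cst c%:E w))).
  apply: ge0_le_integral => //.
  - move=> w _; apply: integral_ge0 => w' _; exact: phi_ge0.
  - exact: measurable_X.
  - by apply: emeasurable_funD.
  - move=> w _; have [->|/eqP wz] := eqVneq (X n w) z.
      by rewrite /= (adm_x0 hphi) add0e c_fin.
    by rewrite (adm_harmonic hphi wz) leeDl// lee_fin.
rewrite ge0_integralD//.
by rewrite integral_prob_cst lte_add_pinfty// ltry.
Qed.

(** As [phi] is harmonic outside of [z] and vanishes at [z], it is a
    martingale when stopped at the first visit to [z] after time [n]. *)
Lemma integral_phi_stopped x n k A : Fn n A ->
  \int[P x]_(w in A `&` avoids_upto n (n + k) z) (phi (X (n + k) w))%:E =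
  \int[P x]_(w in A) (phi (X n w))%:E.
Proof.
move=> FA; elim: k => [|k IH]; first by rewrite addn0 avoids_upto0 setIT.
rewrite addnS avoids_uptoS ?leq_addr// setIA -IH.
set B := A `&` _.
have FB : Fn (n + k) B.
  by apply: FnI; [exact: (Fn_le (leq_addr k n))|exact: Fn_avoids_upto].
rewrite (integral_next hE hP (f := EFin \o phi)); last 2 first.
- by move=> y; rewrite lee_fin (adm_ge0 hphi).
- by apply: FnI => //; exact: Fn_X.
rewrite integral_mkcondr; apply: eq_integral => w _; rewrite patchE.
case: ifPn; rewrite ?inE => wz; first exact: (adm_harmonic hphi).
by move: wz; rewrite notin_setE /= => /contrapT ->; rewrite (adm_x0 hphi).
Qed.

End admissible_function.
End last_exit.

(** * The construction yields a last-exit family *)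

Section construction_to_last_exit.
Context {R : realType} {E : pointedType}.
Hypothesis hE : countable [set: E].
Variables (p : E -> E -> R) (P : E -> probability (traj E) R).
Hypothesis hP : markov_chain p P.
Hypothesis hfin : finite_branching p.
Hypothesis hirr : irreducible_chain P.
Hypothesis hrec : recurrent_chain P.
Implicit Types (A B : set (traj E)) (x y : E).
Variables (phi : E -> R) (z : E) (r : R).
Hypothesis hphi : admissible P phi z.
Hypothesis hr : (0 < r < 1)%R.
Local Notation c := (fine (Enext P (EFin \o phi) z)).

Let phi_ge0 w n : 0 <= (phi (X n w) : R)%:E.
Proof. by rewrite lee_fin (adm_ge0 hphi). Qed.
Let mphi n : measurable_fun [set: traj E] (fun w => (phi (X n w))%:E).
Proof. exact: (measurable_X (fun x => (phi x)%:E)). Qed.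
Let mX n y : measurable [set w : traj E | X n w = y].
Proof. exact: (measurable_coord n [set y]). Qed.
Let c_ge0 : (0 <= c)%R.
Proof. by rewrite fine_ge0// integral_ge0// => w _; exact: (phi_ge0 w 1). Qed.
Let r_ge0 : (0 <= r)%R. Proof. by case/andP: hr => /ltW. Qed.
Let c'_ge0 : (0 <= r / (1 - r) * c)%R.
Proof. by rewrite mulr_ge0// divr_ge0// subr_ge0; case/andP: hr => _ /ltW. Qed.

(** Before the first visit to [z] after time [n] the weight [r ^+ Lpre z n]
    does not move, so that the density is a constant plus the stopped
    martingale. The constant part disappears in the limit by recurrence. *)
Lemma construction_avoids (mu : {finite_measure set (traj E) -> \bar R}) x n j B :
  is_mu P phi z r x mu -> Fn n B -> B `<=` Lpre z n @^-1` [set j] ->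
  mu (B `&` avoids n z) = (r ^+ j)%:E * \int[P x]_(w in B) (phi (X n w))%:E.
Proof.
move=> hmu FB Bj; set K := \int[P x]_(w in B) _.
have mB := Fn_measurable FB.
pose F k := B `&` avoids_upto n (n + k) z.
have FF k : Fn (n + k) (F k).
  by apply: FnI; [exact: (Fn_le (leq_addr k n))|exact: Fn_avoids_upto].
have mF k := Fn_measurable (FF k).
have muF k : mu (F k) = (r ^+ j)%:E * ((r / (1 - r) * c)%:E * P x (F k) + K).
  rewrite (hmu _ _ (FF k)) -integral_cstP// /K.
  rewrite -(integral_phi_stopped hE hP hphi x k FB) -/(F k).
  rewrite -ge0_integralD//; last exact: measurable_funTS.
  rewrite -ge0_integralZl//; last 3 first.
  - by apply: measurable_funTS; apply: emeasurable_funD.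
  - by move=> w _; rewrite adde_ge0// lee_fin.
  - by rewrite lee_fin exprn_ge0.
  apply: eq_integral => w /[!inE] -[Bw wF].
  by rewrite (Lpre_avoids_upto (leq_addr _ _) wF) (Bj _ Bw) mulrC EFinM.
have ni (m1 m2 : nat) : (m1 <= m2)%N -> (F m2 <= F m1)%O.
  move=> mm; apply/subsetPset => w [Bw wF]; split => // m /andP[nm mk].
  by apply: wF; rewrite nm (leq_trans mk)// leq_add2l.
have capF : \bigcap_k F k = B `&` avoids n z.
  rewrite avoids_bigcap; apply/seteqP; split => w.
    by move=> h; split => [|k _]; [have [] := h 0%N I|have [] := h k I].
  by move=> [Bw h] k _; split => //; exact: h.
have mcap : measurable (\bigcap_k F k) by exact: bigcapT_measurable.
have cvg_mu : mu (F k) @[k --> \oo] --> mu (\bigcap_k F k).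
  apply: nonincreasing_cvg_mu => //; first by rewrite ltey_eq fin_num_measure.
have cvg_P : P x (F k) @[k --> \oo] --> P x (\bigcap_k F k).
  by apply: nonincreasing_cvg_mu => //; rewrite ltey_eq fin_num_measure.
have P0 : P x (\bigcap_k F k) = 0.
  apply: (@subset_measure0 _ _ _ (P x) _ (avoids n z)) => //.
  - exact: measurable_avoids.
  - by rewrite capF => w [].
  - exact: (prob_avoids hE hP).
rewrite P0 in cvg_P.
rewrite -capF -(cvg_lim _ cvg_mu)//; apply/cvg_lim => //.
under eq_fun do rewrite muF.
apply: cvgeZl => //; rewrite -[X in _ --> X]add0e.
apply: cvgeD => //; last exact: cvg_cst.
by rewrite -[X in _ --> X](mule0 (r / (1 - r) * c)%:E); apply: cvgeZl.
Qed.

(** A trajectory with infinitely many visits makes a visit number [k+1],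
    where the density is [psi z * r ^+ k]; the visits number [k+1] at distinct
    times exclude each other, and [k] is arbitrary. *)
Lemma construction_io (mu : {finite_measure set (traj E) -> \bar R}) x :
  is_mu P phi z r x mu -> mu (infinitely_often z) = 0.
Proof.
move=> hmu.
pose V k := \bigcup_m visit z k m.
have mvisit k m : measurable (visit z k m) by exact: Fn_measurable (@Fn_visit E z k m).
have mV k : measurable (V k) by exact: bigcupT_measurable.
have muV k : mu (infinitely_often z) <= (psi P phi z r z * r ^+ k)%:E.
  have psi0 : (0 <= psi P phi z r z * r ^+ k)%R.
    by rewrite mulr_ge0// ?exprn_ge0// /psi addr_ge0// (adm_ge0 hphi).
  apply: (@le_trans _ _ (mu (V k))).
    apply: le_measure; rewrite ?inE//; first exact: measurable_io.
    move=> w wio; have [|m wm] := @io_visit E z k 0 w wio.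
      by rewrite /Lpre big_ord0.
    by exists m.
  apply: (@le_trans _ _ ((psi P phi z r z * r ^+ k)%:E * P x (V k))); last first.
    by rewrite -[leRHS]mule1 lee_wpmul2l// ?lee_fin// probability_le1.
  have tV : trivIset setT (visit z k) by exact: trivIset_visit.
  rewrite [X in X <= _]measure_semi_bigcup//; last exact: mV.
  rewrite [X in _ <= _ * X]measure_semi_bigcup//; last exact: mV.
  rewrite -nneseriesZl//.
  apply: lee_nneseries => [m _ _|m _]; first exact: measure_ge0.
  have muvis : mu (visit z k m) = (psi P phi z r z * r ^+ k)%:E * P x (visit z k m).
    rewrite (hmu m); last exact: Fn_visit.
    rewrite -integral_cstP; last exact: Fn_measurable (@Fn_visit E z k m).
    by apply: eq_integral => w /[!inE] -[-> ->].
  by rewrite le_eqVlt; apply/orP; left; apply/eqP; exact: muvis.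
apply/eqP; rewrite -measure_le0.
have cvg0 : (psi P phi z r z * r ^+ k)%:E @[k --> \oo] --> 0%:E.
  apply: cvg_EFin; first by apply: nearW.
  rewrite -(mulr0 (psi P phi z r z)); apply: cvgZr.
  apply: cvg_expr; by rewrite ger0_norm//; case/andP: hr.
rewrite -[X in _ <= X](cvg_lim _ cvg0)//.
by apply: lime_ge; [apply/cvg_ex; eexists; exact: cvg0|exact: nearW].
Qed.

(** Once split along the values of [Lpre z n], the density [rNLoo] is constant
    on trajectories that avoid [z] from time [n] on, and cancels the weight. *)
Theorem last_exit_of_construction (Q : E -> {measure set (traj E) -> \bar R}) :
  is_Qfamily P phi z r Q -> last_exit_family P phi z Q.
Proof.
move=> hQ x; have [mu hmu QE] := hQ x; split=> [n A FA|]; last first.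
  rewrite (QE _ (measurable_io z)); apply: null_set_integral.
  - exact: measurable_io.
  - by apply: measurable_funTS; exact: measurable_rNLoo.
  - exact: construction_io hmu.
have mA := Fn_measurable FA; have mav : measurable (avoids n z) := measurable_avoids n z.
have mL k : measurable (Lpre z n @^-1` [set k]) by exact: Fn_measurable (@Fn_Lpre E z n _).
rewrite -[LHS]mul1e -integral_cst; last exact: measurableI.
rewrite (integral_level_sum _ mL)//; last exact: measurableI.
rewrite [RHS](integral_level_sum _ mL)//.
apply: eq_eseriesr => j _.
set B := A `&` Lpre z n @^-1` [set j].
have FB : Fn n B by apply: FnI => //; exact: Fn_Lpre.
have mB := Fn_measurable FB.
rewrite setIAC -/B integral_cst ?mul1e; last exact: measurableI.
rewrite QE; last exact: measurableI.
rewrite (_ : \int[mu]_(w in _) _ = \int[mu]_(w in B `&` avoids n z) cst (r ^- j)%:E w).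
  have muB : mu (B `&` avoids n z) = (r ^+ j)%:E * \int[P x]_(w in B) (phi (X n w))%:E.
    by apply: construction_avoids hmu FB _ => w [].
  rewrite integral_cst; last exact: measurableI.
  rewrite [X in _ * X]muB.
  rewrite muleA -EFinM mulVf ?mul1e// expf_neq0// gt_eqF//.
  by case/andP: hr.
by apply: eq_integral => w /[!inE] -[[_ /= <-] wn]; exact: rNLoo_avoids.
Qed.

End construction_to_last_exit.

(** * Laws of a last-exit family *)

Section exhaustion.
Context {R : realType} {E : pointedType}.
Implicit Types (mu nu : {measure set (traj E) -> \bar R}) (A : set (traj E)) (z : E).

Lemma measure_avoids_cvg mu z A : measurable A -> mu (infinitely_often z) = 0 ->
  mu (A `&` avoids n z) @[n --> \oo] --> mu A.
Proof.
move=> mA mu0.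
have mav n : measurable (avoids n z : set (traj E)) by exact: measurable_avoids.
have mAa n : measurable (A `&` avoids n z) by exact: measurableI.
have mU : measurable (\bigcup_n (avoids n z : set (traj E))) by exact: bigcupT_measurable.
rewrite -(measure_setI_conull mA mU)// setI_bigcupr.
apply: nondecreasing_cvg_mu => //; first exact: bigcupT_measurable.
by move=> m n mn; apply/subsetPset => w [Aw wm]; split => //; exact: avoids_le wm.
Qed.

Lemma measure_avoids0 mu z : (forall n, mu (avoids n z) = 0) ->
  mu (~` infinitely_often z) = 0.
Proof.
move=> mu0; rewrite setCK.
have : mu (avoids n z) @[n --> \oo] --> mu (\bigcup_n avoids n z).
  apply: nondecreasing_cvg_mu; first by move=> n; exact: measurable_avoids.
    by apply: bigcupT_measurable => n; exact: measurable_avoids.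
  by move=> m n mn; apply/subsetPset; exact: avoids_le.
by under eq_fun do rewrite mu0; move=> /cvg_lim <-//; rewrite lim_cst.
Qed.

(** The trajectories that avoid [z] from time [n] on exhaust the space as [n]
    grows, up to a null set; on each of these pieces the events of the
    filtration form a generating pi-system. *)
Lemma measure_ext_avoids mu nu z :
  (forall n A, Fn n A -> mu (A `&` avoids n z) = nu (A `&` avoids n z)) ->
  (forall n, mu (avoids n z) < +oo) ->
  mu (infinitely_often z) = 0 -> nu (infinitely_often z) = 0 ->
  forall A, measurable A -> mu A = nu A.
Proof.
move=> munu mufin mu0 nu0.
have mav n : measurable (avoids n z : set (traj E)) by exact: measurable_avoids.
have restrE n A : measurable A -> mrestr mu (mav n) A = mrestr nu (mav n) A.
  pose G : set (set (traj E)) := \bigcup_k @Fn E k.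
  move=> mA; apply: (measure_unique G (fun=> setT)) => //.
  - apply/seteqP; split; last first.
      apply: smallest_sub => [|B [k _]]; first exact: sigma_algebra_measurable.
      exact: Fn_measurable.
    apply: smallest_sub => [|_ [k _ [B ->]]]; first exact: smallest_sigma_algebra.
    by apply: sub_sigma_algebra; exists k => //; exact: Fn_X.
  - move=> B C [k _ FB] [m _ FC]; exists (maxn k m) => //; apply: FnI.
      exact: Fn_le (leq_maxl k m) FB.
    exact: Fn_le (leq_maxr k m) FC.
  - by move=> _; exists 0%N => //; exact: FnT.
  - by rewrite bigcup_const.
  - move=> B [k _ FB]; rewrite /= /mrestr (avoids_split z (leq_maxl n k)) setIA.
    apply: munu; apply: FnI; first exact: Fn_le (leq_maxr n k) FB.
    exact: Fn_avoids_upto.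
  - by move=> _; rewrite /= /mrestr setTI.
move=> A mA.
rewrite -(cvg_lim _ (measure_avoids_cvg mA mu0))// -(cvg_lim _ (measure_avoids_cvg mA nu0))//.
by congr (limn _); apply/funext => n; exact: restrE.
Qed.

End exhaustion.

Section last_exit_laws.
Context {R : realType} {E : pointedType}.
Hypothesis hE : countable [set: E].
Variables (p : E -> E -> R) (P : E -> probability (traj E) R).
Hypothesis hP : markov_chain p P.
Hypothesis hfin : finite_branching p.
Hypothesis hirr : irreducible_chain P.
Hypothesis hrec : recurrent_chain P.
Implicit Types (A B : set (traj E)) (x y : E).
Variables (phi : E -> R) (z : E).
Hypothesis hphi : admissible P phi z.
Variable Q : E -> {measure set (traj E) -> \bar R}.
Hypothesis hQ : last_exit_family P phi z Q.
Local Notation c := (fine (Enext P (EFin \o phi) z)).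

Let phi_ge0 w n : 0 <= (phi (X n w) : R)%:E.
Proof. by rewrite lee_fin (adm_ge0 hphi). Qed.
Let phiE_ge0 y : 0 <= (EFin \o phi) y.
Proof. by rewrite lee_fin (adm_ge0 hphi). Qed.
Let mphi n : measurable_fun [set: traj E] (fun w => (phi (X n w))%:E).
Proof. exact: (measurable_X (fun x => (phi x)%:E)). Qed.
Let mX n y : measurable [set w : traj E | X n w = y].
Proof. exact: (measurable_coord n [set y]). Qed.
Let c_fin : c%:E = Enext P (EFin \o phi) z.
Proof. by rewrite fineK// (Enext_fin hE hP hfin)//; exact: adm_ge0 hphi. Qed.
Let c_ge0 : (0 <= c)%R.
Proof. by rewrite fine_ge0// integral_ge0// => w _; exact: (phi_ge0 w 1). Qed.

Lemma last_exit_fin x n : Q x (avoids n z) < +oo.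
Proof.
have [/(_ n setT (@FnT _ _)) + _] := hQ x; rewrite setTI => ->.
exact: (integral_phi_fin hE hP hfin hphi).
Qed.

Lemma last_exit_at x m A : Fn m A ->
  Q x (A `&` [set w | X m w = z] `&` avoids m.+1 z) = c%:E * P x (A `&` [set w | X m w = z]).
Proof.
move=> FA.
have FAz : Fn m (A `&` [set w | X m w = z]).
  by apply: FnI => //; exact: (@Fn_X _ m m [set z]).
rewrite (hQ x).1; last exact: Fn_le (leqnSn m) FAz.
rewrite (integral_next hE hP (f := EFin \o phi))// c_fin.
rewrite (@integral_const_X _ _ P (Enext P (EFin \o phi)) x m _ z)//.
- by move=> y; apply: integral_ge0 => w _; exact: (phi_ge0 w 1).
- exact: Fn_measurable FAz.
Qed.

(** Joint law of the past before [n] and of the total local time at [z]. The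
    first term is a last exit before time [n]. A last exit at time [n + m]
    which is the visit number [k] has mass [c] times the probability of that
    visit, and by recurrence the visit number [k] almost surely exists: hence
    the second term. *)
Lemma last_exit_total_visits x n k A : Fn n A ->
  Q x (A `&` total_visits R z k) =
  \int[P x]_(w in A `&` Lpre z n @^-1` [set k]) (phi (X n w))%:E +
  c%:E * P x (A `&` Lpre z n @^-1` [set j | (j < k)%N]).
Proof.
move=> FA; have mA := Fn_measurable FA.
have mav m : measurable (avoids m z : set (traj E)) by exact: measurable_avoids.
(* On [W m], the visit of time [n + m] has number [k]; [W m] is empty if
   [k = 0]. *)
pose W m := A `&` Lpre z (n + m) @^-1` [set j | j.+1 = k] `&` [set w | X (n + m) w = z].
have FAL m : Fn (n + m) (A `&` Lpre z (n + m) @^-1` [set j | j.+1 = k]).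
  by apply: FnI; [exact: Fn_le (leq_addr m n) FA|exact: Fn_Lpre].
have mW m : measurable (W m) by apply: measurableI => //; exact: Fn_measurable (FAL m).
have FU : Fn n (A `&` Lpre z n @^-1` [set k]) by apply: FnI => //; exact: Fn_Lpre.
have -> : A `&` total_visits R z k =
    (A `&` Lpre z n @^-1` [set k] `&` avoids n z) `|`
    \bigcup_m (W m `&` avoids (n + m).+1 z).
  rewrite (total_visitsE n) setIUr setIA; congr (_ `|` _).
  apply/seteqP; split => w.
    move=> [Aw [m _ [[/= + wm] wS]]]; rewrite LpreS wm eqxx addn1 => Lm.
    by exists m.
  move=> [m _ [[[Aw /= Lm] wm] wS]]; split => //; exists m => //; split => //.
  by split => //=; rewrite LpreS wm eqxx addn1.
have mWa m : measurable (W m `&` avoids (n + m).+1 z) by exact: measurableI.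
rewrite measureU//; first last.
- apply/seteqP; split => // w [[_ wn] [m _ [[_ wm] _]]].
  by apply: (wn (n + m)%N) => //; exact: leq_addr.
- exact: bigcupT_measurable.
- by apply: measurableI => //; exact: Fn_measurable FU.
congr (_ + _); first exact: (hQ x).1.
have W_inj m m' w : W m w -> W m' w -> m = m'.
  move=> [[_ /= Lm] wm] [[_ /= Lm'] wm']; apply/eqP; rewrite -(eqn_add2l n); apply/eqP.
  apply: (@visit_inj E z (Lpre z (n + m) w)); split => //.
  by apply: succn_inj; rewrite Lm.
have trW : trivIset setT W.
  apply/trivIsetP => i j _ _ /eqP ij; apply/seteqP; split => // w [wi wj].
  by apply: ij; exact: W_inj wi wj.
have trWa : trivIset setT (fun m => W m `&` avoids (n + m).+1 z).
  apply/trivIsetP => i j _ _ /eqP ij; apply/seteqP; split => // w [[wi _] [wj _]].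
  by apply: ij; exact: W_inj wi wj.
rewrite [LHS]measure_semi_bigcup//; last exact: bigcupT_measurable.
transitivity (\sum_(i <oo) c%:E * P x (W i)).
  by apply: eq_eseriesr => m _; exact: last_exit_at.
rewrite nneseriesZl//; congr (_ * _).
transitivity (P x (\bigcup_m W m)).
  by rewrite [RHS]measure_semi_bigcup//; exact: bigcupT_measurable.
have mAL : measurable (A `&` Lpre z n @^-1` [set j | (j < k)%N]).
  by apply: measurableI => //; exact: Fn_measurable (@Fn_Lpre E z n _).
have subW : \bigcup_m W m `<=` A `&` Lpre z n @^-1` [set j | (j < k)%N].
  move=> w [m _ [[Aw /= Lm] _]]; split => //=.
  by rewrite -Lm ltnS; apply: Lpre_mono; exact: leq_addr.
apply/eqP; rewrite eq_le; apply/andP; split.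
  by apply: le_measure; rewrite ?inE//; exact: bigcupT_measurable.
rewrite -[X in X <= _](@measure_setI_conull _ _ (P x) _ (infinitely_often z))//; last 2 first.
- exact: measurable_io.
- by apply: measure_avoids0 => m; exact: (prob_avoids hE hP).
apply: le_measure; rewrite ?inE//.
- by apply: measurableI => //; exact: measurable_io.
- exact: bigcupT_measurable.
move=> w [[Aw /= Lk] wio].
have k0 : k.-1.+1 = k by rewrite prednK//; exact: leq_ltn_trans Lk.
have [|m [Lm wm]] := @io_visit E z k.-1 n w wio; first by rewrite -ltnS k0.
by exists m => //; split => //; split => //=; rewrite Lm.
Qed.

(** Both sides are measures in [B], and on events [C] of the filtration cut by
    [avoids m z] they reduce to the Markov property of the chain. *)
Theorem last_exit_markov x n A y B : Fn n A -> measurable B ->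
  Q x (A `&` [set w | X n w = y] `&` tshift n @^-1` B) =
  P x (A `&` [set w | X n w = y]) * Q y B.
Proof.
move=> FA mB.
have FAy : Fn n (A `&` [set w | X n w = y]).
  by apply: FnI => //; exact: (@Fn_X _ n n [set y]).
have mA' := Fn_measurable FAy.
set A' := A `&` _ in FAy mA' *.
have A'fin : P x A' \is a fin_num by rewrite fin_num_measure.
pose d : {nonneg R} := NngNum (fine_ge0 (measure_ge0 (P x) A')).
have mS (C : set (traj E)) : measurable C -> measurable (tshift n @^-1` C).
  by move=> ?; rewrite -[X in measurable X]setTI; exact: measurable_tshift.
transitivity (mscale d (Q y) B); last by rewrite /mscale /= fineK.
rewrite -[LHS]/(restr_tshift (Q x) n mA' B).
apply: (@measure_ext_avoids _ _ _ _ z) => //.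
- move=> m C FC; rewrite /= /restr_tshift /mscale preimage_setI avoids_tshift setIA.
  have FAC : Fn (n + m) (A' `&` tshift n @^-1` C).
    by apply: FnI; [exact: Fn_le (leq_addr m n) FAy|exact: Fn_tshift].
  have mC := Fn_measurable FC.
  rewrite (hQ x).1// (hQ y).1//.
  rewrite -ge0_integral_mscale//; last exact: measurable_funTS.
  apply: (@integral_coord_ext _ _ hE _ _ (n + m) m) => //.
    exact: Fn_measurable FAC.
  move=> z'.
  have mCz : measurable (C `&` [set w | X m w = z']) by exact: measurableI.
  rewrite ge0_integral_mscale//; last exact: measurable_funTS.
  rewrite (@integral_const_X _ _ P (EFin \o phi) x (n + m) _ z')//; last first.
    by apply: measurableI => //; exact: Fn_measurable FAC.
  rewrite (@integral_const_X _ _ P (EFin \o phi) y m _ z')//= fineK//.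
  rewrite muleCA; congr (_ * _).
  rewrite -(markov_property hE hP x y FA mCz); congr (P x _).
  by rewrite preimage_setI setIA.
- move=> m; rewrite /= /restr_tshift avoids_tshift.
  apply: le_lt_trans (last_exit_fin x (n + m)).
  by apply: le_measure; rewrite ?inE//; [apply: measurableI => //|]; exact: measurable_avoids.
- apply: (@subset_measure0 _ _ _ (Q x) _ (infinitely_often z)).
  + by apply: measurableI => //; apply: mS; exact: measurable_io.
  + exact: measurable_io.
  + move=> w [_ wio] [m _ wm]; apply: wio; exists m => // k mk.
    by apply: (wm (n + k)%N); exact: leq_trans mk (leq_addl _ _).
  + exact: (hQ x).2.
- by rewrite /= /mscale (hQ y).2 mule0.
Qed.

Lemma last_exit_shift x n A B : Fn n A -> measurable B ->
  Q x (A `&` tshift n @^-1` B) = \int[P x]_(w in A) Q (X n w) B.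
Proof.
move=> FA mB; have mA := Fn_measurable FA.
have mS : measurable (tshift n @^-1` B).
  by rewrite -[X in measurable X]setTI; exact: measurable_tshift.
rewrite -[LHS]mul1e -integral_cst; last exact: measurableI.
apply: (@integral_coord_ext _ _ hE _ _ n n) => //; first exact: measurableI.
  exact: (measurable_X (fun y => Q y B)).
move=> y.
rewrite (@integral_const_X _ _ P (Q ^~ B) x n _ y)//; last exact: measurableI.
rewrite integral_cst ?mul1e; last by apply: measurableI => //; exact: measurableI.
by rewrite setIAC [RHS]muleC -last_exit_markov.
Qed.

End last_exit_laws.

(** * A last-exit family comes from the construction *)

Lemma nneseriesS (R : realType) (f : nat -> \bar R) : (forall k, 0 <= f k) ->
  \sum_(k <oo) f k = f 0%N + \sum_(k <oo) f k.+1.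
Proof.
move=> f0; rewrite nneseries_recl// -nneseries_addn//.
by under eq_eseriesr do rewrite addn1.
Qed.

Lemma nneseries_level (R : realType) (s a b : R) j :
  (0 < s < 1)%R -> (0 <= a)%R -> (0 <= b)%R ->
  \sum_(k <oo) (s ^+ k * (if k == j then a else if (j < k)%N then b else 0))%:E =
  (s ^+ j * (s / (1 - s) * b + a))%:E.
Proof.
move=> /andP[s0 s1] a0 b0.
have term_ge0 i k : 0 <= (s ^+ k * (if k == i then a else if (i < k)%N then b else 0))%:E.
  rewrite lee_fin mulr_ge0 ?exprn_ge0 ?(ltW s0)//.
  by case: (k == i) => //; case: (i < k)%N.
elim: j => [|j IH].
  rewrite nneseriesS//= !expr0 !mul1r addrC EFinD; congr (_ + _).
  transitivity (\sum_(0 <= k <oo) (geometric (s * b)%R s k)%:E).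
    by apply: eq_eseriesr => k _; rewrite /geometric/= exprS mulrAC.
  apply/cvg_lim => //.
  under eq_fun do rewrite sumEFin.
  have -> : (s / (1 - s) * b = s * b * (1 - s)^-1)%R by rewrite mulrAC.
  apply: cvg_EFin; first exact: nearW.
  by apply: cvg_geometric_series; rewrite gtr0_norm.
rewrite nneseriesS//= mulr0 add0e.
rewrite exprS -mulrA EFinM -IH -nneseriesZl//.
by apply: eq_eseriesr => k _; rewrite exprS -EFinM -mulrA eqSS ltnS.
Qed.

(** A carrier for the structure of finite measure, on a measure whose
    finiteness is known only through a proof. *)
Section finite_measure_of.
Context d (T : measurableType d) (R : realType).
Variables (m : {measure set T -> \bar R}) (mfin : fin_num_fun m).

Definition finite_measure_of (_ : fin_num_fun m) : set T -> \bar R := m.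
Local Notation mu := (finite_measure_of mfin).

HB.instance Definition _ := Measure.on mu.
HB.instance Definition _ := Measure_isFinite.Build _ _ _ mu mfin.

End finite_measure_of.

Section last_exit_to_construction.
Context {R : realType} {E : pointedType}.
Hypothesis hE : countable [set: E].
Variables (p : E -> E -> R) (P : E -> probability (traj E) R).
Hypothesis hP : markov_chain p P.
Hypothesis hfin : finite_branching p.
Hypothesis hirr : irreducible_chain P.
Hypothesis hrec : recurrent_chain P.
Implicit Types (A B : set (traj E)) (x y : E).
Variables (phi : E -> R) (z : E).
Hypothesis hphi : admissible P phi z.
Variable Q : E -> {measure set (traj E) -> \bar R}.
Hypothesis hQ : last_exit_family P phi z Q.
Variable s : R.
Hypothesis hs : (0 < s < 1)%R.
Local Notation c := (fine (Enext P (EFin \o phi) z)).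

Let phi_ge0 w n : 0 <= (phi (X n w) : R)%:E.
Proof. by rewrite lee_fin (adm_ge0 hphi). Qed.
Let mphi n : measurable_fun [set: traj E] (fun w => (phi (X n w))%:E).
Proof. exact: (measurable_X (fun x => (phi x)%:E)). Qed.
Let c_ge0 : (0 <= c)%R.
Proof. by rewrite fine_ge0// integral_ge0// => w _; exact: (phi_ge0 w 1). Qed.
Let s_ge0 : (0 <= s)%R. Proof. by case/andP: hs => /ltW. Qed.

Let psi_ge0 y : (0 <= psi P phi z s y)%R.
Proof.
rewrite /psi addr_ge0//; last exact: adm_ge0 hphi _.
by rewrite mulr_ge0// divr_ge0// subr_ge0; case/andP: hs => _ /ltW.
Qed.

Let sk (k : nat) : {nonneg R} := NngNum (exprn_ge0 k s_ge0).
Let level_measure x k : {measure set (traj E) -> \bar R} :=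
  mscale (sk k) (mrestr (Q x) (measurable_total_visits (R := R) z k)).
(** The measure of density [s] to the power [Loo z] with respect to [Q x]. *)
Let discounted x : {measure set (traj E) -> \bar R} := mseries (level_measure x) 0.

Let discountedE x A :
  discounted x A = \sum_(k <oo) (s ^+ k)%:E * Q x (A `&` total_visits R z k).
Proof. by []. Qed.

Let discounted_level x n j B : Fn n B -> B `<=` Lpre z n @^-1` [set j] ->
  discounted x B = \int[P x]_(w in B) (psi P phi z s (X n w) * s ^+ Lpre z n w)%:E.
Proof.
move=> FB Bj; have mB := Fn_measurable FB.
set K := \int[P x]_(w in B) (phi (X n w))%:E.
have K0 : 0 <= K by apply: integral_ge0 => w _; exact: phi_ge0.
have Kfin : K%E \is a fin_num.
  rewrite ge0_fin_numE//; apply: le_lt_trans (integral_phi_fin hE hP hfin hphi x n).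
  by apply: ge0_subset_integral.
have Pfin : P x B \is a fin_num by rewrite fin_num_measure.
have BI (N : set nat) : B `&` Lpre z n @^-1` N = if `[< N j >] then B else set0.
  case: asboolP => Nj; apply/seteqP; split => w //; first by case.
  - by move=> Bw; split => //=; rewrite (Bj _ Bw).
  - by move=> [Bw] /=; rewrite (Bj _ Bw).
rewrite discountedE.
transitivity (\sum_(k <oo) (s ^+ k * (if k == j then fine K
    else if (j < k)%N then c * fine (P x B) else 0))%:E).
  apply: eq_eseriesr => k _.
  rewrite (last_exit_total_visits hE hP hfin hirr hrec hphi hQ x k FB) !BI EFinM; congr (_ * _).
  have -> : `[< [set k] j >] = (k == j) by apply/asboolP/eqP => ->.
  have -> : `[< (j < k)%N >] = (j < k)%N by apply/asboolP/idP.
  case: eqP => [->|_].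
    by rewrite ltnn measure0 mule0 adde0 fineK.
  rewrite integral_set0 add0e; case: ifP => _; last by rewrite measure0 mule0.
  by rewrite EFinM (fineK Pfin).
rewrite nneseries_level ?mulr_ge0 ?c_ge0 ?fine_ge0//.
transitivity (\int[P x]_(w in B)
    ((s ^+ j)%:E * (cst (s / (1 - s) * c)%:E w + (phi (X n w))%:E))); last first.
  apply: eq_integral => w /[!inE] Bw.
  by rewrite (Bj _ Bw) [in RHS]mulrC EFinM.
have c'_ge0 : (0 <= s / (1 - s) * c)%R.
  by rewrite mulr_ge0// divr_ge0// subr_ge0; case/andP: hs => _ /ltW.
rewrite ge0_integralZl//; last 3 first.
- by apply: measurable_funTS; apply: emeasurable_funD.
- by move=> w _; rewrite adde_ge0// lee_fin.
- by rewrite lee_fin exprn_ge0.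
rewrite ge0_integralD//; last exact: measurable_funTS.
rewrite integral_cstP// -/K mulrA EFinM EFinD.
by rewrite (EFinM _ (fine (P x B))) (fineK Pfin) (fineK Kfin).
Qed.

Let discounted_is_mu x : is_mu P phi z s x (discounted x).
Proof.
move=> n A FA; have mA := Fn_measurable FA.
have mL k : measurable (Lpre z n @^-1` [set k]) by exact: Fn_measurable (@Fn_Lpre E z n _).
rewrite -[LHS]mul1e -integral_cst// (integral_level_sum _ mL)//.
rewrite [RHS](integral_level_sum _ mL)//; last 2 first.
- apply/measurable_EFinP; apply: measurable_funM.
    exact: (measurable_X (psi P phi z s)).
  exact: (measurable_Lpre (fun k => (s ^+ k)%R)).
- by move=> w; rewrite lee_fin mulr_ge0 ?exprn_ge0.
apply: eq_eseriesr => j _.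
have FB : Fn n (A `&` Lpre z n @^-1` [set j]) by apply: FnI => //; exact: Fn_Lpre.
have mB := Fn_measurable FB.
rewrite integral_cst// mul1e; apply: (@discounted_level x n j _ FB); exact: subIsetr.
Qed.

Let discounted_fin x : fin_num_fun (discounted x).
Proof.
apply: lty_fin_num_fun.
rewrite (discounted_is_mu x (@FnT E 0)).
under eq_integral do rewrite /Lpre big_ord0 expr0 mulr1.
rewrite (integral_start hE hP (f := fun y => (psi P phi z s y)%:E))//.
by rewrite probability_setT mule1 ltry.
Qed.

(** On the level [k] of the total local time the two densities are [s ^+ k]
    and [s ^- k], so that they cancel; the levels cover [Q x]-almost
    everything. *)
Theorem construction_of_last_exit : is_Qfamily P phi z s Q.
Proof.
move=> x; exists (finite_measure_of (discounted_fin x)); first exact: discounted_is_mu.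
move=> A mA.
rewrite (eq_measure_integral (discounted x)); last by [].
rewrite ge0_integral_measure_series//; last 2 first.
- by move=> w _; exact: rNLoo_ge0.
- by apply: measurable_funTS; exact: measurable_rNLoo.
have mT k : measurable (total_visits R z k : set (traj E)) by exact: measurable_total_visits.
transitivity (\sum_(k <oo) Q x (A `&` total_visits R z k)).
  rewrite -[LHS](@measure_setI_conull _ _ _ _ (~` infinitely_often z))//; last 2 first.
  - by apply: measurableC; exact: measurable_io.
  - by rewrite setCK (hQ x).2.
  rewrite (@setC_infinitely_often R E z) setI_bigcupr measure_semi_bigcup//.
  - by move=> k; exact: measurableI.
  - exact: trivIset_total_visits.
  - by apply: bigcupT_measurable => k; exact: measurableI.
apply: eq_eseriesr => k _.
rewrite ge0_integral_mscale//; last 2 first.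
- by apply: measurable_funTS; exact: measurable_rNLoo.
- by move=> w _; exact: rNLoo_ge0.
rewrite (@ae_eq_integral _ _ _ _ _ (cst (s ^- k)%:E))//; last 2 first.
- by apply: measurable_funTS; exact: measurable_rNLoo.
- exists (~` total_visits R z k); split.
  + exact: measurableC.
  + by rewrite /= /mrestr setICl measure0.
  move=> w /= nw wk; apply: nw => _.
  have [n _ wn] : (\bigcup_n avoids n z) w.
    by apply: contrapT => wio; exact: (Loo_io wio wk).
  rewrite (rNLoo_avoids _ wn); congr (_ ^- _)%:E.
  have [] : (Lpre z n @^-1` [set k] `&` avoids n z) w by rewrite -(total_visits_avoids (R := R)).
  by [].
rewrite integral_cst//= /mrestr muleA -EFinM divff ?mul1e//.
by rewrite expf_neq0// gt_eqF//; case/andP: hs.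
Qed.

End last_exit_to_construction.

(** * Changing the base point *)

Lemma le_measureU_bigcup d (T : measurableType d) (R : realType)
    (mu : {measure set T -> \bar R}) (A B : set T) (F : nat -> set T) (C : \bar R) :
  measurable A -> measurable B -> (forall m, measurable (F m)) ->
  A `<=` B `|` \bigcup_m F m -> \sum_(m <oo) mu (F m) <= C -> mu A <= mu B + C.
Proof.
move=> mA mB mF AB FC; have mU : measurable (\bigcup_m F m) by exact: bigcupT_measurable.
apply: (@le_trans _ _ (mu (B `|` \bigcup_m F m))).
  by apply: le_measure; rewrite ?inE//; exact: measurableU.
apply: (@le_trans _ _ (mu B + mu (\bigcup_m F m))); first exact: measureU2.
apply: leeD2l.
by apply: le_trans FC; exact: measure_sigma_subadditive.
Qed.

Section change_of_point.
Context {R : realType} {E : pointedType}.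
Hypothesis hE : countable [set: E].
Variables (p : E -> E -> R) (P : E -> probability (traj E) R).
Hypothesis hP : markov_chain p P.
Hypothesis hfin : finite_branching p.
Hypothesis hirr : irreducible_chain P.
Hypothesis hrec : recurrent_chain P.
Implicit Types (A B : set (traj E)) (x y : E).
Variables (phi : E -> R) (x0 : E).
Hypothesis hphi : admissible P phi x0.
Variable Q : E -> {measure set (traj E) -> \bar R}.
Hypothesis hQ : last_exit_family P phi x0 Q.
Local Notation c := (fine (Enext P (EFin \o phi) x0)).

Let mX n y : measurable [set w : traj E | X n w = y].
Proof. exact: (measurable_coord n [set y]). Qed.
Let mav n y : measurable (avoids n y : set (traj E)).
Proof. exact: measurable_avoids. Qed.
Let c_ge0 : (0 <= c)%R.
Proof. by rewrite fine_ge0// integral_ge0// => w _; rewrite lee_fin (adm_ge0 hphi). Qed.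

Lemma phibrE y0 y : phibr Q y0 y = Q y (avoids 0 y0).
Proof. by rewrite /phibr /Qavoid /mrestr setTI. Qed.

Lemma phibr_center y : phibr Q x0 y = (phi y)%:E.
Proof.
rewrite phibrE -[avoids 0 x0]setTI (hQ y).1; last exact: FnT.
rewrite (integral_start hE hP (f := EFin \o phi))//.
  by rewrite probability_setT mule1.
by move=> x; rewrite lee_fin (adm_ge0 hphi).
Qed.

Lemma last_exit_pass x n m y :
  Q x (avoids n x0 `&` [set w | X (n + m) w = y]) =
  (phi y)%:E * P x (avoids_upto n (n + m) x0 `&` [set w | X (n + m) w = y]).
Proof.
rewrite (avoids_split x0 (leq_addr m n)) setIAC.
have FB : Fn (n + m) (avoids_upto n (n + m) x0 `&` [set w | X (n + m) w = y]).
  by apply: FnI; [exact: Fn_avoids_upto|exact: (@Fn_X _ (n + m) _ [set y])].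
rewrite (hQ x).1//.
apply: (@integral_const_X _ _ P (EFin \o phi)) => //.
  by move=> z; rewrite lee_fin (adm_ge0 hphi).
exact: Fn_measurable FB.
Qed.

(** By Borel-Cantelli: on trajectories that avoid [x0] from time [n] on, the
    mass of a visit to [y0] at time [n + m] is [phi y0] times a term of the
    killed Green function, which is summable. *)
Lemma last_exit_io x y0 : Q x (infinitely_often y0) = 0.
Proof.
have [C C0 green] := green_bound hE hP hirr y0 x0.
have io_avoids n : Q x (infinitely_often y0 `&` avoids n x0) = 0.
  pose F m := avoids n x0 `&` [set w | X (n + m) w = y0].
  have mF m : measurable (F m) by exact: measurableI.
  apply: (@subset_measure0 _ _ _ (Q x) _ (lim_sup_set F)).
  - by apply: measurableI => //; exact: measurable_io.
  - by apply: bigcapT_measurable => k; exact: bigcup_measurable.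
  - move=> w [wio wn] k _.
    have [m nm wm] : exists2 m, (n + k <= m)%N & X m w = y0.
      apply: contrapT => nw; apply: wio; exists (n + k)%N => // m nm wm.
      by apply: nw; exists m.
    have nm' : (n <= m)%N by exact: leq_trans (leq_addr _ _) nm.
    exists (m - n)%N; first by rewrite /= leq_subRL.
    by split => //=; rewrite subnKC.
  - apply: lim_sup_set_cvg0 => //.
    under eq_eseriesr do rewrite last_exit_pass.
    rewrite nneseriesZl//.
    apply: (@le_lt_trans _ _ ((phi y0)%:E * C%:E)).
      by apply: lee_wpmul2l => //; rewrite lee_fin (adm_ge0 hphi).
    by rewrite -EFinM ltry.
have := measure_avoids_cvg (measurable_io y0) (hQ x).2.
by under eq_fun do rewrite io_avoids; move=> /cvg_lim <-//; rewrite lim_cst.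
Qed.

(** The events of avoiding [y0] and of avoiding [x0] differ by trajectories
    that avoid [x0] and visit [y0], and by trajectories that avoid [y0] and have
    a last visit to [x0]. Summing over the time of that visit turns each mass
    into a multiple of a killed Green function. *)
Lemma phibr_bound y0 : exists2 C : R, (0 <= C)%R &
  forall y, phibr Q y0 y <= (phi y)%:E + C%:E /\ (phi y)%:E <= phibr Q y0 y + C%:E.
Proof.
have [C1 C10 green1] := green_bound hE hP hirr y0 x0.
have [C2 C20 green2] := green_bound hE hP hirr x0 y0.
have phi0 y : (0 <= phi y)%R := adm_ge0 hphi y.
exists (c * C2 + phi y0 * C1)%R; first by rewrite addr_ge0// mulr_ge0.
have mup m : measurable (avoids_upto 0 m y0) by exact: Fn_measurable (@Fn_avoids_upto E 0 m y0).
move=> y; rewrite -phibr_center !phibrE EFinD; split.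
  have mio : measurable (~` infinitely_often x0) by apply: measurableC; exact: measurable_io.
  rewrite -(measure_setI_conull (mav 0 y0) mio); last by rewrite setCK (hQ y).2.
  apply: (le_measureU_bigcup
    (F := fun m => avoids_upto 0 m y0 `&` [set w | X m w = x0] `&` avoids m.+1 x0)) => //.
  - exact: measurableI.
  - by move=> m; apply: measurableI => //; exact: measurableI.
  - move=> w [wa]; rewrite /infinitely_often setCK => -[N _ wN].
    have [w0|[m wm wm']] := @last_visit E 0 N x0 w wN; first by left.
    by right; exists m => //; split => //; split => // k /andP[_ _]; exact: wa.
  - under eq_eseriesr.
      move=> m _; rewrite (last_exit_at hE hP hfin hphi hQ y (@Fn_avoids_upto E 0 m y0)).
      over.
    rewrite nneseriesZl//; apply: (@le_trans _ _ (c * C2)%:E).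
      by rewrite EFinM; apply: lee_wpmul2l; [rewrite lee_fin|exact: green2].
    by rewrite leeDl// lee_fin mulr_ge0.
apply: (le_measureU_bigcup (F := fun m => avoids 0 x0 `&` [set w | X m w = y0])) => //.
- by move=> m; exact: measurableI.
- move=> w wa; have [w0|w0] := pselect (avoids 0 y0 w); first by left.
  right; apply: contrapT => nw; apply: w0 => m _ wm; apply: nw.
  by exists m.
- under eq_eseriesr do rewrite (last_exit_pass y 0).
  rewrite nneseriesZl//; apply: (@le_trans _ _ (phi y0 * C1)%:E).
    by rewrite EFinM; apply: lee_wpmul2l; [rewrite lee_fin|exact: green1].
  by rewrite leeDr// lee_fin mulr_ge0.
Qed.

Section new_function.
Variable y0 : E.
Local Notation phi' := (fine \o phibr Q y0).

Lemma phibr_ge0 y : 0 <= phibr Q y0 y.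
Proof. by rewrite phibrE. Qed.

Lemma phibr_fin y : phibr Q y0 y \is a fin_num.
Proof.
have [C C0 /(_ y)[h _]] := phibr_bound y0.
by rewrite ge0_fin_numE ?phibr_ge0//; apply: le_lt_trans h _; rewrite -EFinD ltry.
Qed.

Lemma EFin_phibr : EFin \o phi' = phibr Q y0.
Proof. by apply/funext => y /=; rewrite fineK// phibr_fin. Qed.

Lemma last_exit_avoids x n A : Fn n A ->
  Q x (A `&` avoids n y0) = \int[P x]_(w in A) phibr Q y0 (X n w).
Proof.
move=> FA; rewrite -[in LHS](addn0 n) -avoids_tshift.
rewrite (last_exit_shift hE hP hfin hphi hQ)//.
by apply: eq_integral => w _; rewrite phibrE.
Qed.

Lemma last_exit_start x A : measurable A -> Q x (A `&` [set w | X 0 w = x]) = Q x A.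
Proof.
move=> mA; apply: measure_setI_conull => //.
rewrite -[~` _]setIT -(preimage_setT (tshift 0)).
rewrite (last_exit_shift hE hP hfin hphi hQ)//; last first.
  by apply: FnC; exact: (@Fn_X _ 0 0 [set x]).
(* The mass [Q x setT] may be infinite, but its factor vanishes. *)
rewrite (integral_start hE hP (f := fun y => Q y setT))//; last exact: measurableC.
by rewrite probability_setC// (mc_start hP) subee// mule0.
Qed.

Lemma phibr_pole : phibr Q y0 y0 = 0.
Proof.
rewrite phibrE -last_exit_start// (_ : _ `&` _ = set0) ?measure0//.
by apply/seteqP; split => // w [w0 /= wy]; exact: (w0 0%N).
Qed.

Lemma Enext_phibr y : Enext P (phibr Q y0) y = Q y (avoids 1 y0).
Proof. by rewrite -[avoids 1 y0]setTI last_exit_avoids//; exact: FnT. Qed.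

Lemma phibr_harmonic y : y <> y0 -> Enext P (phibr Q y0) y = phibr Q y0 y.
Proof.
move=> yy0; rewrite Enext_phibr phibrE -[LHS]last_exit_start// -[RHS]last_exit_start//.
congr (Q y _); apply/seteqP; split => w [w1 /= wy]; split => //; last first.
  exact: avoids_le w1.
by move=> [|m] _; [rewrite wy|exact: w1].
Qed.

Lemma phibr_admissible : admissible P phi' y0.
Proof.
split.
- by move=> x; rewrite /= fine_ge0// phibr_ge0.
- by rewrite /= phibr_pole.
- by move=> x xy0; rewrite EFin_phibr phibr_harmonic//= fineK// phibr_fin.
move=> [M hM]; apply: (adm_unbounded hphi).
have [C C0 hC] := phibr_bound y0; exists (M + C)%R => x.
rewrite -lee_fin EFinD; apply: le_trans (hC x).2 _; apply: leeD2r.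
by rewrite -(fineK (phibr_fin x)) lee_fin; exact: hM.
Qed.

(** This contains the whole change of point: the shift identity for the
    event of avoiding [y0] is the last-exit identity for [phi']. *)
Lemma phibr_last_exit : last_exit_family P phi' y0 Q.
Proof.
move=> x; split; last exact: last_exit_io.
move=> n A FA; rewrite last_exit_avoids//.
by apply: eq_integral => w _; rewrite /= fineK// phibr_fin.
Qed.

End new_function.

Lemma last_exit_sigma_finite x : sigma_finite [set: traj E] (Q x).
Proof.
exists (fun n => if n is m.+1 then avoids m x0 else infinitely_often x0).
  apply/seteqP; split => // w _.
  have [wio|] := pselect (infinitely_often x0 w); first by exists 0%N.
  by rewrite /infinitely_often => /contrapT[m _ wm]; exists m.+1.
move=> [|m]; split.
- exact: measurable_io.
- by rewrite (hQ x).2.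
- exact: mav.
- exact: (last_exit_fin hE hP hfin hphi hQ).
Qed.

Lemma last_exit_unique (Q' : E -> {measure set (traj E) -> \bar R}) :
  last_exit_family P phi x0 Q' -> forall x A, measurable A -> Q' x A = Q x A.
Proof.
move=> hQ' x A mA; apply: (@measure_ext_avoids _ _ _ _ x0) => //.
- by move=> n B FB; rewrite (hQ x).1// (hQ' x).1.
- by move=> n; exact: (last_exit_fin hE hP hfin hphi hQ').
- exact: (hQ' x).2.
- exact: (hQ x).2.
Qed.

Lemma total_visits_law y k : (1 <= k)%N ->
  Q y (total_visits R x0 k) = Enext P (EFin \o phi) x0.
Proof.
move=> k1; rewrite -[total_visits R x0 k]setTI.
rewrite (last_exit_total_visits hE hP hfin hirr hrec hphi hQ y k (@FnT E 0)).
have L0 w : Lpre x0 0 w = 0%N by rewrite /Lpre big_ord0.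
rewrite (_ : _ `&` _ @^-1` [set k] = set0); last first.
  by apply/seteqP; split => // w [_ /=]; rewrite L0 => k0; rewrite -k0 in k1.
rewrite (_ : _ `&` _ @^-1` `I_k = setT); last first.
  by apply/seteqP; split => // w _; split => //=; rewrite L0.
rewrite integral_set0 add0e probability_setT mule1 fineK//.
by apply: (Enext_fin hE hP hfin); exact: adm_ge0 hphi.
Qed.

End change_of_point.

(** * The theorem *)

Theorem theorem4p2p5 (R : realType) (E : pointedType)
  (hE : countable [set: E])
  (p : E -> E -> R) (P : E -> probability (traj E) R)
  (hP : markov_chain p P) (hfin : finite_branching p)
  (hirr : irreducible_chain P) (hrec : recurrent_chain P)
  (x0 : E) (phi : E -> R) (hphi : admissible P phi x0)
  (r : R) (hr : (0 < r < 1)%R)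
  (Q : E -> {measure set (traj E) -> \bar R})
  (hQ : is_Qfamily P phi x0 r Q) :
  (* (i) *)
  [/\ forall y, phibr Q x0 y = (phi y)%:E &
      forall y0, exists C : R, forall y,
        `| phibr Q y0 y - (phi y)%:E | <= C%:E] /\
  (* (ii) *)
  (forall y0,
    [/\ forall y, phibr Q y0 y \is a fin_num,
        forall y, y <> y0 -> Enext P (phibr Q y0) y = phibr Q y0 y,
        phibr Q y0 y0 = 0 &
        Qnoreturn Q y0 [set: traj E] = Enext P (phibr Q y0) y0]) /\
  (* (iii) *)
  (forall y0,
    [/\ admissible P (fine \o phibr Q y0) y0,
        forall x, sigma_finite [set: traj E] (Q x) &
        forall s : R, (0 < s < 1)%R ->
          is_Qfamily P (fine \o phibr Q y0) y0 s Q /\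
          forall Q' : E -> {measure set (traj E) -> \bar R},
            is_Qfamily P (fine \o phibr Q y0) y0 s Q' ->
            forall x A, measurable A -> Q' x A = Q x A]) /\
  (* (iv) *)
  (forall y0 y,
    Q y [set w | Loo y0 w = 0 :> \bar R] = phibr Q y0 y /\
    forall k : nat, (1 <= k)%N ->
      Q y [set w | Loo y0 w = k%:R%:E :> \bar R] =
      Enext P (phibr Q y0) y0).
Proof.
have exitQ : last_exit_family P phi x0 Q.
  exact: (last_exit_of_construction hE hP hirr hrec hphi hr hQ).
have fin_phibr y0 y := phibr_fin hE hP hfin hirr hphi exitQ y0 y.
have adm y0 := phibr_admissible hE hP hfin hirr hphi exitQ y0.
have exit' y0 := phibr_last_exit hE hP hfin hirr hphi exitQ y0.
split; [split|split; [|split]].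
- exact: (phibr_center hE hP hphi exitQ).
- move=> y0; have [C _ hC] := phibr_bound hE hP hfin hirr hphi exitQ y0.
  exists C => y; have [h1 h2] := hC y; move: h1 h2.
  rewrite -(fineK (fin_phibr y0 y)) -!EFinD abse_EFin !lee_fin => h1 h2.
  by rewrite ler_distl lerBlDr h2.
- move=> y0; split.
  + exact: fin_phibr.
  + by move=> y; exact: (phibr_harmonic hE hP hfin hphi exitQ).
  + exact: (phibr_pole hE hP hfin hphi exitQ).
  + by rewrite (Enext_phibr hE hP hfin hphi exitQ) /Qnoreturn /mrestr setTI.
- move=> y0; split => //.
    by move=> x; exact: (last_exit_sigma_finite hE hP hfin hphi exitQ).
  move=> s hs; split.
    exact: (construction_of_last_exit hE hP hfin hirr hrec (adm y0) (exit' y0) hs).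
  move=> Q' /(last_exit_of_construction hE hP hirr hrec (adm y0) hs).
  exact: (last_exit_unique hE hP hfin (adm y0) (exit' y0)).
- move=> y0 y; split.
    by rewrite phibrE -(total_visits0 (R := R)).
  move=> k k1; rewrite -(EFin_phibr hE hP hfin hirr hphi exitQ).
  exact: (total_visits_law hE hP hfin hirr hrec (adm y0) (exit' y0) y k1).
Qed.
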